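(* Let $n$ be a nonnegative integer and suppose $bc=a^2q^{n+1}$ and $de=aq^{n+1}$. Then \begin{multline*} \sum_{k=0}^{\lfloor n/2 \rfloor} \frac{E(aq^{4k})}{E(a)} \frac{(b,c;q^3,p)_k}{(aq/b,aq/c;q,p)_k} \frac{(q^{-n};q,p)_{2k}}{(aq^{n+1};q,p)_{2k}} \frac{(d,e;q,p)_k}{(aq^3/d,aq^3/e;q^3,p)_k}\, q^k \\ =\frac{(aq;q,p)_n\,(aq^{2-n}/b;q^3,p)_n} {(aq/b;q,p)_n\,(aq^{2-n};q^3,p)_n} \,{_{10}\omega_9}(a^2/de;b,c,a/d,a/e,q^{2-n},q^{1-n},q^{-n};q^3,p). \end{multline*}
   Context: Let $p$ be a complex number with $|p|<1$, $q$ a nonzero complex number, and all parameters generic so that no denominator vanishes. For nonzero $x$, $E(x)=E(x;p)=\prod_{k\ge 0}(1-xp^k)(1-p^{k+1}/x)$. For a nonzero base $Q$ and integer $m$, $(a;Q,p)_m=\prod_{k=0}^{m-1}E(aQ^k)$ if $m>0$, $=1$ if $m=0$, and $=1/\prod_{k=0}^{-m-1}E(aQ^{m+k})$ if $m<0$; $(a_1,\dots,a_s;Q,p)_m=\prod_{i=1}^s(a_i;Q,p)_m$. For parameters with $(a_4\cdots a_{r+1})^2=a_1^{r-3}Q^{r-5}$ and one of $a_4,\dots,a_{r+1}$ of the form $Q^{-N}$ ($N$ a nonnegative integer), \[{_{r+1}\omega_r}(a_1;a_4,\dots,a_{r+1};Q,p)=\sum_{k\ge 0}\frac{E(a_1Q^{2k})}{E(a_1)}\frac{(a_1,a_4,\dots,a_{r+1};Q,p)_k\,Q^k}{(Q,a_1Q/a_4,\dots,a_1Q/a_{r+1};Q,p)_k}.\]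 (In the ${_{10}\omega_9}$ above, whichever of $q^{2-n},q^{1-n},q^{-n}$ is an integer power $q^{-3N}$ of the base $q^3$ makes the series terminate.) *)

(* Defs.v *)
From HB Require Import structures.
From mathcomp Require Import all_boot all_order all_algebra.
From mathcomp Require Import all_classical all_reals all_analysis.
From mathcomp Require Import complex.
Import Order.TTheory GRing.Theory Num.Theory.
Import numFieldNormedType.Exports.

Set Implicit Arguments.
Unset Strict Implicit.
Unset Printing Implicit Defensive.

Local Open Scope ring_scope.

(* The complex numbers R[i] (R a real closed field of reals), viewed as a
   numClosedFieldType so that MathComp-Analysis' topology (limits) applies. *)
Definition CC (R : realType) : numClosedFieldType := R[i].

Definition Eth (R : realType) (p x : CC R) : CC R :=
  limn (fun N : nat => \prod_(k < N) ((1 - x * p ^+ k) * (1 - p ^+ k.+1 / x))).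

Definition epoch (R : realType) (p Q a : CC R) (m : nat) : CC R :=
  \prod_(k < m) Eth p (a * Q ^+ k).

(* The k-th term of the very-well-poised series r+1 omega r (a1; s; Q, p),
   where s = [:: a4; ...; a_{r+1}]. *)
Definition omega_term (R : realType) (p Q a1 : CC R) (s : seq (CC R)) (k : nat)
  : CC R :=
  Eth p (a1 * Q ^+ (2 * k)) / Eth p a1
  * (epoch p Q a1 k * \prod_(x <- s) epoch p Q x k * Q ^+ k)
  / (epoch p Q Q k * \prod_(x <- s) epoch p Q (a1 * Q / x) k).

(* Terminating very-well-poised series: when one of the a_i equals Q^(-N),
   every term with index k > N has a vanishing factor E(1) = 0 in its numerator,
   so the series is the finite sum over 0 <= k <= N. *)
Definition omega_term_sum (R : realType) (N : nat) (p Q a1 : CC R)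
  (s : seq (CC R)) : CC R :=
  \sum_(k < N.+1) omega_term p Q a1 s k.

(* Main.v *)
Require Import Defs.
From HB Require Import structures.
From mathcomp Require Import all_boot all_order all_algebra.
From mathcomp Require Import all_classical all_reals all_analysis.
From mathcomp Require Import complex.
From mathcomp Require Import zify ring lra.
Import Order.TTheory GRing.Theory Num.Theory.
Import numFieldNormedType.Exports.
Local Open Scope ring_scope.

Set Implicit Arguments.
Unset Strict Implicit.
Unset Printing Implicit Defensive.

(* Write [x] for the odd theta function E(q^x) / q^(x/2), which satisfies the
   three-term (Weierstrass) relation, and f_b(x) = [x-b][x-c], f_d(x) = [x-d][x-e];
   the sums b + c and d + e are fixed.  Both sides of the transformation
   are sums of products of values of f_b with coefficients depending on d.
   Repeated use of the three-term relation expands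
   - prod_(l<m) f_b(g-1-ep-3l), where n = 2m + ep and g = a + m, in the products
     prod_(i<k) f_b(-3i) prod_(l<m-k) f_b(g-l); the coefficients obey a Pascal
     recursion in m that has a product solution for ep = 0 and ep = 1 only;
   - prod_(i<k) f_d(-i), by Lagrange interpolation at the points a + 3j, which is
     the factor (d,e;q)_k / (aq^3/d,aq^3/e;q^3)_k of the left-hand side.
   Inserting the second expansion in the left-hand side and exchanging the sums
   gives inner sums which the first one, shifted by a -> a + 4j, n -> n - 2j,
   b -> b + 3j, evaluates, and this is the right-hand side.

   The three-term relation follows from the triple product: writing theta for the
   Laurent series, theta(xy) theta(x/y) / x has the form A(x) B(y) - B(x) A(y), so
   the relation is a Pluecker identity.

   These expansions divide by more theta values than the statement does, hence
   they need generic q, a, b, d; the general case is a limit. *)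

(** * The transformation for an odd function with a three-term relation *)

(** The first expansion is the transformation at [d = a]: there [a/d = 1] cuts the omega series down
    to its first term, so what the recursion in [m] proves is a summation formula. The nodes
    [a + 3j] are chosen so that a Lagrange basis product divided by [(aq^3/d,aq^3/e;q^3)_k] does not
    depend on [k]; it telescopes to the factor of the omega series that carries [d] and [e], and
    this is what allows the sums to be exchanged. The algebra only sees an odd function on a
    commutative ring of exponents: shifts of arguments are identities for [ring], and the powers of
    [q] are collected once, when theta functions are translated. In the triple product the central
    Gaussian binomial is a common factor that only has to stay bounded, so the Pluecker identity is
    exact at every finite stage. The final limit multiplies [q], [a], [b], [d] by real factors: the
    zeros of theta have countably many moduli, so generic factors exist arbitrarily close to 1, and
    [c] and [e] are recomputed from the two balancing conditions. *)

Section OddFunction.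
Variables (V : comNzRingType) (F : fieldType) (s : V -> F).

(* In terms of x - beta/2 and y - beta/2 this is s(x-y) s(x+y); the shift by beta
   avoids a division by 2 in [V]. *)
Definition thetaS (beta x y : V) : F := s (x - y) * s (x + y - beta).

(** Additive form of [(q^x; q^t)_k], up to a power of [q]; the step [t] will be 1 or 3. *)
Definition sfact (t x : V) (k : nat) : F := \prod_(i < k) s (x + t * i%:R).

Hypothesis sN : forall x, s (- x) = - s x.
Hypothesis s0 : s 0 = 0.
Hypothesis addS : forall beta x y z w,
  thetaS beta x y * thetaS beta z w - thetaS beta x z * thetaS beta y w
  + thetaS beta x w * thetaS beta y z = 0.

Lemma thetaSC beta x y : thetaS beta y x = - thetaS beta x y.
Proof. by rewrite /thetaS -(opprB x y) sN mulNr (addrC y x). Qed.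

(** The relation [addS] says that, as functions of [z], all [thetaS beta u z] lie in the plane
    spanned by those for [x] and [y]; each of these two vanishes at its own node. *)
Lemma thetaS_interp beta u x y z : thetaS beta x y != 0 ->
  thetaS beta u z = thetaS beta u x / thetaS beta y x * thetaS beta y z
               + thetaS beta u y / thetaS beta x y * thetaS beta x z.
Proof.
move=> xy0; apply: (mulIf xy0).
have H := addS beta u z x y.
rewrite (thetaSC _ x y).
have -> : thetaS beta u z * thetaS beta x y = thetaS beta u x * thetaS beta z y - thetaS beta u y * thetaS beta z x.
  apply/eqP; rewrite -subr_eq0 -H; apply/eqP; ring.
rewrite (thetaSC _ y z) (thetaSC _ x z) ?invrN; by field.
Qed.

(** Lagrange interpolation: the basis product that omits the node [j] vanishes at every other
    node. *)
Lemma lagrange_thetaS beta (u x : nat -> V) (z : V) (k : nat) :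
  (forall i j, i != j -> thetaS beta (x i) (x j) != 0) ->
  \prod_(i < k) thetaS beta (u i) z =
  \sum_(j < k.+1) (\prod_(i < k) thetaS beta (u i) (x j)
     / \prod_(i < k.+1 | i != j) thetaS beta (x i) (x j))
     * \prod_(i < k.+1 | i != j) thetaS beta (x i) z.
Proof.
move=> nz; elim: k z => [|k IH] z.
  rewrite big_ord_recl !big_ord0 addr0.
  rewrite !big_pred0 ?divr1 ?mulr1 // => i; by rewrite ord1 eqxx.
rewrite big_ord_recr /= IH mulr_suml [RHS]big_ord_recr /=.
have nej (j : 'I_k.+1) : (j : nat) != k.+1 by rewrite neq_ltn ltn_ord.
have prodS (j : 'I_k.+1) (f : nat -> F) :
   \prod_(i < k.+2 | i != widen_ord (leqnSn k.+1) j) f i =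
   (\prod_(i < k.+1 | i != j) f i) * f k.+1.
  rewrite big_mkcond big_ord_recr /= -big_mkcond /=.
  rewrite -(inj_eq val_inj) /= eq_sym nej; congr (_ * _).
have prodl (f : nat -> F) :
   \prod_(i < k.+2 | i != ord_max) f i = \prod_(i < k.+1) f i.
  rewrite big_mkcond big_ord_recr /= eqxx mulr1; apply: eq_bigr => i _.
  by rewrite -(inj_eq val_inj) /= nej.
(* The new factor is interpolated at a pair depending on [j]. The first part extends the basis
   product of [j] by the new node; the second part turns every basis product into that of the new
   node. *)
have itp (j : 'I_k.+1) (X : F) : X * thetaS beta (u k) z =
    X * (thetaS beta (u k) (x j) / thetaS beta (x k.+1) (x j) * thetaS beta (x k.+1) z)
    + X * (thetaS beta (u k) (x k.+1) / thetaS beta (x j) (x k.+1) * thetaS beta (x j) z).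
  by rewrite -mulrDr [in RHS]addrC -thetaS_interp // nz // eq_sym nej.
under eq_bigr => j _ do rewrite (itp j).
rewrite big_split /=; congr (_ + _).
  apply: eq_bigr => j _.
  rewrite (prodS j (fun i => thetaS beta (x i) (x j))).
  rewrite (prodS j (fun i => thetaS beta (x i) z)).
  rewrite big_ord_recr /= (thetaSC _ (x j) (x k.+1)).
  have h1 : thetaS beta (x j) (x k.+1) != 0 by rewrite nz ?nej.
  have h2 : \prod_(i < k.+1 | i != j) thetaS beta (x i) (x j) != 0.
    by apply/prodf_neq0 => i ij; apply: nz.
  by field; rewrite oppr_eq0 h1 h2.
rewrite (prodl (fun i => thetaS beta (x i) z)) (prodl (fun i => thetaS beta (x i) (x k.+1))).
set X := \prod_(i < k.+1) thetaS beta (x i) z.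
have h0 : \prod_(i < k.+1) thetaS beta (x i) (x k.+1) != 0.
  by apply/prodf_neq0 => i _; apply: nz.
(* The coefficient of the new node is found from the induction hypothesis at [z = x k.+1]. *)
rewrite [\prod_(i < k.+1) thetaS beta (u i) _]big_ord_recr /= IH !mulr_suml.
apply: eq_bigr => j _.
have h1 : thetaS beta (x j) (x k.+1) != 0 by rewrite nz ?nej.
have h2 : \prod_(i < k.+1 | i != j) thetaS beta (x i) (x j) != 0.
  by apply/prodf_neq0 => i ij; apply: nz.
rewrite /X [\prod_(i < k.+1) thetaS beta (x i) z](bigD1 j) //=.
rewrite (bigD1 j) //= in h0.
have {h0} h0 : \prod_(i < k.+1 | i != j) thetaS beta (x i) (x k.+1) != 0.
  by apply: contraNneq h0 => ->; rewrite mulr0.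
rewrite [\prod_(i < k.+1) thetaS beta (x i) (x k.+1)](bigD1 j) //=.
by field; rewrite h0 h1 h2.
Qed.

Lemma sfact0 t x : sfact t x 0 = 1.
Proof. by rewrite /sfact big_ord0. Qed.

Lemma sfactSr t x k : sfact t x k.+1 = sfact t x k * s (x + t * k%:R).
Proof. by rewrite /sfact big_ord_recr. Qed.

Lemma sfactD t x k l : sfact t x (k + l) = sfact t x k * sfact t (x + t * k%:R) l.
Proof.
rewrite /sfact big_split_ord /=; congr (_ * _).
by apply: eq_bigr => i _; congr s; ring.
Qed.

Lemma sfactSl t x k : sfact t x k.+1 = s x * sfact t (x + t) k.
Proof. by rewrite -add1n sfactD /sfact big_ord1 !mulr0 addr0 mulr1. Qed.

Lemma sfact_neq0 t x k : (forall i : nat, (i < k)%N -> s (x + t * i%:R) != 0) ->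
  sfact t x k != 0.
Proof. by move=> H; apply/prodf_neq0 => i _; apply: H. Qed.

(** * Cubic coefficients and their Pascal recursion *)

Definition cubic_ratio (a n k : V) : F :=
  s (a + 4 * k + 4) / s (a + 4 * k)
  * (s (n - 2 * k) * s (n - 2 * k - 1))
    / (s (a + n + 2 * k + 1) * s (a + n + 2 * k + 2))
  * (s (a + k) * s (n + k + 1)) / (s (3 * k + 3) * s (a - n + 3 * k + 2)).

(* The k-th term of the left-hand side at d = a, without its factors depending on
   b and c, divided by the prefactor of the right-hand side. *)
Definition cubic_coef (a : V) (n k : nat) : F :=
  sfact 3 (a - n%:R + 2) n / sfact 1 (a + 1) n
  * \prod_(i < k) cubic_ratio a n%:R i%:R.

(** The quotient of [cubic_coef (a - 1) n.+2 k] by [cubic_coef a n k]: the change of parameters from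
    [m] to [m.+1] when [a = g - m] and [n = 2m + ep]. *)
Definition cubic_shift (a n k : V) : F :=
  s (a + 4 * k - 1) / s (a + 4 * k)
  * (s (n + k + 1) * s (n + k + 2)) / (s (n - 2 * k + 1) * s (n - 2 * k + 2))
  * (s (a - n + 3 * k - 1) * s (a + 2 * n + 2))
    / (s (a + k - 1) * s (a + n + 2 * k + 1)).

Hypothesis nzZ : forall z : int, z != 0 -> s z%:~R != 0.

Lemma odd_intr_neq0 (x : V) (z : int) : x = z%:~R -> z != 0 -> s x != 0.
Proof. by move=> ->; apply: nzZ. Qed.

(** Two routes from [(a, n, k)] to [(a - 1, n + 2, k + 1)]. Once the arguments are normalized the
    factors cancel in pairs, without any three-term relation. *)
Lemma cubic_shiftS a (n k : nat) : (forall z : int, s (a + z%:~R) != 0) ->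
  (2 * k.+1 <= n)%N ->
  cubic_shift a n%:R k%:R * cubic_ratio (a - 1) n.+2%:R k%:R
  = cubic_ratio a n%:R k%:R * cubic_shift a n%:R k.+1%:R.
Proof.
move=> nza kn; rewrite /cubic_ratio /cubic_shift.
have nzA z x : x = a + z%:~R -> s x != 0 by move=> ->; apply: nza.
rewrite (_ : a - 1 + 4 * k%:R + 4 = a + 4 * k.+1%:R - 1); last by ring.
rewrite (_ : a - 1 + 4 * k%:R = a + 4 * k%:R - 1); last by ring.
rewrite (_ : n.+2%:R - 2 * k%:R - 1 = n%:R - 2 * k%:R + 1); last by ring.
rewrite (_ : n.+2%:R - 2 * k%:R = n%:R - 2 * k%:R + 2); last by ring.
rewrite (_ : a - 1 + n.+2%:R + 2 * k%:R + 1 = a + n%:R + 2 * k%:R + 2); last by ring.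
rewrite (_ : a - 1 + n.+2%:R + 2 * k%:R + 2 = a + n%:R + 2 * k.+1%:R + 1); last by ring.
rewrite (_ : a - 1 + k%:R = a + k%:R - 1); last by ring.
rewrite (_ : n.+2%:R + k%:R + 1 = n%:R + k.+1%:R + 2); last by ring.
rewrite (_ : a - 1 - n.+2%:R + 3 * k%:R + 2 = a - n%:R + 3 * k%:R - 1); last by ring.
rewrite (_ : a + 4 * k%:R + 4 = a + 4 * k.+1%:R); last by ring.
rewrite (_ : n%:R - 2 * k.+1%:R + 1 = n%:R - 2 * k%:R - 1); last by ring.
rewrite (_ : n%:R - 2 * k.+1%:R + 2 = n%:R - 2 * k%:R); last by ring.
rewrite (_ : n%:R + k.+1%:R + 1 = n%:R + k%:R + 2); last by ring.
rewrite (_ : a - n%:R + 3 * k.+1%:R - 1 = a - n%:R + 3 * k%:R + 2); last by ring.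
rewrite (_ : a + k.+1%:R - 1 = a + k%:R); last by ring.
have h0 : s (a + n%:R + 2 * k.+1%:R + 1) != 0
  by apply: (@nzA (n%:Z + 2 * k.+1%:Z + 1)); ring.
have h1 : s (a + k%:R) != 0 by apply: (@nzA (k%:Z)); ring.
have h2 : s (a + 4 * k.+1%:R) != 0 by apply: (@nzA (4 * k.+1%:Z)); ring.
have h3 : s (a + n%:R + 2 * k%:R + 1) != 0 by apply: (@nzA (n%:Z + 2 * k%:Z + 1)); ring.
have h4 : s (a + n%:R + 2 * k%:R + 2) != 0 by apply: (@nzA (n%:Z + 2 * k%:Z + 2)); ring.
have h5 : s (a + 4 * k%:R) != 0 by apply: (@nzA (4 * k%:Z)); ring.
have h6 : s (a + 4 * k%:R - 1) != 0 by apply: (@nzA (4 * k%:Z - 1)); ring.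
have h7 : s (a + k%:R - 1) != 0 by apply: (@nzA (k%:Z - 1)); ring.
have h8 : s (a - n%:R + 3 * k%:R + 2) != 0 by apply: (@nzA (3 * k%:Z + 2 - n%:Z)); ring.
have h9 : s (a - n%:R + 3 * k%:R - 1) != 0 by apply: (@nzA (3 * k%:Z - 1 - n%:Z)); ring.
have h10 : s (3 * k%:R + 3) != 0
  by apply: (@odd_intr_neq0 _ (3 * k%:Z + 3)); [ring|clear -kn; lia].
have h11 : s (n%:R - 2 * k%:R) != 0
  by apply: (@odd_intr_neq0 _ (n%:Z - 2 * k%:Z)); [ring|clear -kn; lia].
have h12 : s (n%:R - 2 * k%:R - 1) != 0
  by apply: (@odd_intr_neq0 _ (n%:Z - 2 * k%:Z - 1)); [ring|clear -kn; lia].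
have h13 : s (n%:R - 2 * k%:R + 1) != 0
  by apply: (@odd_intr_neq0 _ (n%:Z - 2 * k%:Z + 1)); [ring|clear -kn; lia].
have h14 : s (n%:R - 2 * k%:R + 2) != 0
  by apply: (@odd_intr_neq0 _ (n%:Z - 2 * k%:Z + 2)); [ring|clear -kn; lia].
by field; rewrite ?h0 ?h1 ?h2 ?h3 ?h4 ?h5 ?h6 ?h7 ?h8 ?h9 ?h10 ?h11 ?h12 ?h13 ?h14.
Qed.

Lemma cubic_coefS a n k :
  cubic_coef a n k.+1 = cubic_coef a n k * cubic_ratio a n%:R k%:R.
Proof. by rewrite /cubic_coef big_ord_recr mulrA. Qed.

Lemma cubic_coef_shift a (n k : nat) : (forall z : int, s (a + z%:~R) != 0) ->
  (2 * k <= n)%N ->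
  cubic_coef (a - 1) n.+2 k = cubic_coef a n k * cubic_shift a n%:R k%:R.
Proof.
move=> nza; have nzA z x : x = a + z%:~R -> s x != 0 by move=> ->; apply: nza.
elim: k => [_|k IH kn].
  rewrite /cubic_coef !big_ord0 !mulr1 /cubic_shift subrK.
  rewrite (_ : a - 1 - n.+2%:R + 2 = a - n%:R - 1); last by ring.
  rewrite sfactSl (sfactSl 1) !sfactSr.
  rewrite (_ : a - n%:R - 1 + 3 = a - n%:R + 2); last by ring.
  rewrite (_ : a - n%:R + 2 + 3 * n%:R = a + 2 * n%:R + 2); last by ring.
  rewrite (_ : a + 1 + 1 * n%:R = a + n%:R + 1); last by ring.
  rewrite (_ : a + 4 * 0%:R - 1 = a - 1); last by ring.
  rewrite (_ : a + 4 * 0%:R = a); last by ring.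
  rewrite (_ : n%:R + 0%:R + 1 = n%:R + 1); last by ring.
  rewrite (_ : n%:R + 0%:R + 2 = n%:R + 2); last by ring.
  rewrite (_ : n%:R - 2 * 0%:R + 1 = n%:R + 1); last by ring.
  rewrite (_ : n%:R - 2 * 0%:R + 2 = n%:R + 2); last by ring.
  rewrite (_ : a - n%:R + 3 * 0%:R - 1 = a - n%:R - 1); last by ring.
  rewrite (_ : a + 0%:R - 1 = a - 1); last by ring.
  rewrite (_ : a + n%:R + 2 * 0%:R + 1 = a + n%:R + 1); last by ring.
have h1 : s (a) != 0 by apply: (@nzA (0)); ring.
have h2 : s (a - 1) != 0 by apply: (@nzA (-1)); ring.
have h3 : s (a + n%:R + 1) != 0 by apply: (@nzA (n%:Z + 1)); ring.
have h4 : s (n%:R + 1) != 0 by apply: (@odd_intr_neq0 _ (n%:Z + 1)); [ring|clear -n; lia].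
have h5 : s (n%:R + 2) != 0 by apply: (@odd_intr_neq0 _ (n%:Z + 2)); [ring|clear -n; lia].
  have h6 : sfact 1 (a + 1) n != 0.
    by apply: sfact_neq0 => i _; apply: (@nzA (i%:Z + 1)); ring.
  by field; rewrite h1 h2 h3 h4 h5 h6.
rewrite !cubic_coefS IH; last by apply: leq_trans kn; rewrite leq_mul2l leqnSn orbT.
by rewrite -[LHS]mulrA -[RHS]mulrA cubic_shiftS.
Qed.

(** The left side is [cubic_coef (a - 1) n.+2 k.+1] over [cubic_coef a n k]. The shift is taken at
    [k] and the index raised afterwards, because at the last [k] the quotient [cubic_shift a n k.+1]
    would have a zero denominator. *)
Lemma cubic_pascal a (n k : nat) : (forall z : int, s (a + z%:~R) != 0) ->
  (2 * k <= n)%N ->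
  cubic_shift a n%:R k%:R * cubic_ratio (a - 1) n.+2%:R k%:R =
  s (n%:R + k%:R + 1) * s (2 * n%:R - k%:R + 2)
    / (s (a + 4 * k%:R) * s (a + n%:R + 2 * k%:R + 1))
  + s (a - n%:R + 3 * k%:R + 2) * s (a + 2 * n%:R + 3 * k%:R + 5)
    / (s (a + 4 * k%:R + 4) * s (a + n%:R + 2 * k%:R + 3)) * cubic_ratio a n%:R k%:R.
Proof.
move=> nza kn; rewrite /cubic_ratio /cubic_shift.
have nzA z x : x = a + z%:~R -> s x != 0 by move=> ->; apply: nza.
(* These points make the three products the numerators of the left side and of the two summands,
   once denominators and common factors are removed. *)
have := addS (-1) (a + n%:R + 2 * k%:R + 2) (n%:R + k%:R + 2) (n%:R - 2 * k%:R - 1) 0.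
rewrite /thetaS.
rewrite (_ : a + n%:R + 2 * k%:R + 2 - (n%:R + k%:R + 2) = a + k%:R); last by ring.
rewrite (_ : a + n%:R + 2 * k%:R + 2 + (n%:R + k%:R + 2) - -1 = a + 2 * n%:R + 3 * k%:R + 5);
  last by ring.
rewrite (_ : n%:R - 2 * k%:R - 1 - 0 = n%:R - 2 * k%:R - 1); last by ring.
rewrite (_ : n%:R - 2 * k%:R - 1 + 0 - -1 = n%:R - 2 * k%:R); last by ring.
rewrite (_ : a + n%:R + 2 * k%:R + 2 - (n%:R - 2 * k%:R - 1) = a + 4 * k%:R + 3);
  last by ring.
rewrite (_ : a + n%:R + 2 * k%:R + 2 + (n%:R - 2 * k%:R - 1) - -1 = a + 2 * n%:R + 2);
  last by ring.
rewrite (_ : n%:R + k%:R + 2 - 0 = n%:R + k%:R + 2); last by ring.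
rewrite (_ : n%:R + k%:R + 2 + 0 - -1 = n%:R + k%:R + 3); last by ring.
rewrite (_ : a + n%:R + 2 * k%:R + 2 - 0 = a + n%:R + 2 * k%:R + 2); last by ring.
rewrite (_ : a + n%:R + 2 * k%:R + 2 + 0 - -1 = a + n%:R + 2 * k%:R + 3); last by ring.
rewrite (_ : n%:R + k%:R + 2 - (n%:R - 2 * k%:R - 1) = 3 * k%:R + 3); last by ring.
rewrite (_ : n%:R + k%:R + 2 + (n%:R - 2 * k%:R - 1) - -1 = 2 * n%:R - k%:R + 2);
  last by ring.
move=> H.
rewrite (_ : a - 1 + 4 * k%:R + 4 = a + 4 * k%:R + 3); last by ring.
rewrite (_ : a - 1 + 4 * k%:R = a + 4 * k%:R - 1); last by ring.
rewrite (_ : n.+2%:R - 2 * k%:R - 1 = n%:R - 2 * k%:R + 1); last by ring.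
rewrite (_ : n.+2%:R - 2 * k%:R = n%:R - 2 * k%:R + 2); last by ring.
rewrite (_ : a - 1 + n.+2%:R + 2 * k%:R + 1 = a + n%:R + 2 * k%:R + 2); last by ring.
rewrite (_ : a - 1 + n.+2%:R + 2 * k%:R + 2 = a + n%:R + 2 * k%:R + 3); last by ring.
rewrite (_ : a - 1 + k%:R = a + k%:R - 1); last by ring.
rewrite (_ : n.+2%:R + k%:R + 1 = n%:R + k%:R + 3); last by ring.
rewrite (_ : a - 1 - n.+2%:R + 3 * k%:R + 2 = a - n%:R + 3 * k%:R - 1); last by ring.
have h0 : s (a + n%:R + 2 * k%:R + 1) != 0 by apply: (@nzA (n%:Z + 2 * k%:Z + 1)); ring.
have h1 : s (a + n%:R + 2 * k%:R + 2) != 0 by apply: (@nzA (n%:Z + 2 * k%:Z + 2)); ring.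
have h2 : s (a + n%:R + 2 * k%:R + 3) != 0 by apply: (@nzA (n%:Z + 2 * k%:Z + 3)); ring.
have h3 : s (a + 4 * k%:R) != 0 by apply: (@nzA (4 * k%:Z)); ring.
have h4 : s (a + 4 * k%:R - 1) != 0 by apply: (@nzA (4 * k%:Z - 1)); ring.
have h5 : s (a + 4 * k%:R + 4) != 0 by apply: (@nzA (4 * k%:Z + 4)); ring.
have h6 : s (a + k%:R - 1) != 0 by apply: (@nzA (k%:Z - 1)); ring.
have h7 : s (a - n%:R + 3 * k%:R + 2) != 0 by apply: (@nzA (3 * k%:Z + 2 - n%:Z)); ring.
have h8 : s (a - n%:R + 3 * k%:R - 1) != 0 by apply: (@nzA (3 * k%:Z - 1 - n%:Z)); ring.
have h9 : s (3 * k%:R + 3) != 0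
  by apply: (@odd_intr_neq0 _ (3 * k%:Z + 3)); [ring|clear -kn; lia].
have h10 : s (n%:R - 2 * k%:R + 1) != 0
  by apply: (@odd_intr_neq0 _ (n%:Z - 2 * k%:Z + 1)); [ring|clear -kn; lia].
have h11 : s (n%:R - 2 * k%:R + 2) != 0
  by apply: (@odd_intr_neq0 _ (n%:Z - 2 * k%:Z + 2)); [ring|clear -kn; lia].
move: H; set X := _ * _ * (s (n%:R - 2 * k%:R - 1) * _).
set Y := _ * _ * (s (n%:R + k%:R + 2) * _) => H.
have {}H : Y = X + s (a + n%:R + 2 * k%:R + 2) * s (a + n%:R + 2 * k%:R + 3)
  * (s (3 * k%:R + 3) * s (2 * n%:R - k%:R + 2)).
  by apply/esym/eqP; rewrite -subr_eq0 -H; apply/eqP; ring.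
transitivity (s (n%:R + k%:R + 1) * Y / (s (a + 4 * k%:R)
  * s (a + n%:R + 2 * k%:R + 1) * s (a + n%:R + 2 * k%:R + 2)
  * s (a + n%:R + 2 * k%:R + 3) * s (3 * k%:R + 3))).
  by rewrite /Y; field; rewrite ?h0 ?h1 ?h2 ?h3 ?h4 ?h5 ?h6 ?h7 ?h8 ?h9 ?h10 ?h11.
by rewrite H /X; field; rewrite ?h0 ?h1 ?h2 ?h3 ?h4 ?h5 ?h6 ?h7 ?h8 ?h9 ?h10 ?h11.
Qed.

Lemma cubic_ratio_eq0 a (m ep : nat) : (ep < 2)%N ->
  cubic_ratio a (2 * m + ep)%:R m%:R = 0.
Proof.
rewrite /cubic_ratio; case: ep => [|[|//]] _.
  rewrite (_ : (2 * m + 0)%:R - 2 * m%:R = 0); last by ring.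
  by rewrite s0 !(mul0r, mulr0).
rewrite (_ : (2 * m + 1)%:R - 2 * m%:R - 1 = 0); last by ring.
by rewrite s0 !(mul0r, mulr0).
Qed.

(** Stated in [g] because [b + c = 2a + n + 1 = 2g + 1 + ep] then stays constant in the induction on
    [m], while [a = g - m] and [n = 2m + ep] move to [a - 1] and [n + 2]. *)
Lemma cubic_expansion (ep m : nat) (g b : V) : (ep < 2)%N ->
  (forall z : int, s (g + z%:~R) != 0) ->
  let K x := thetaS (2 * g + 1 + ep%:R) x b in
  \prod_(l < m) K (g - 1 - ep%:R - 3 * l%:R) =
  \sum_(k < m.+1) cubic_coef (g - m%:R) (2 * m + ep) k
    * (\prod_(i < k) K (- (3 * i%:R)) * \prod_(l < m - k) K (g - l%:R)).
Proof.
move=> ep2 nzg K; elim: m => [|m IH].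
  rewrite big_ord1 !big_ord0 !mulr1 /cubic_coef big_ord0 mulr1 muln0 add0n subr0.
  case: ep ep2 {K} => [|[|//]] _; first by rewrite !sfact0 divr1.
  rewrite !sfactSr !sfact0 !mul1r !mulr0 !addr0.
  rewrite (_ : g - 1 + 2 = g + 1); last by ring.
  by rewrite divff //; apply: (nzg 1).
rewrite big_ord_recr /= IH mulr_suml.
set a := g - m%:R; set n := (2 * m + ep)%N.
have aE : a = g - m%:R by [].
have nE : n%:R = 2 * m%:R + ep%:R :> V by rewrite /n; ring.
have nza z : s (a + z%:~R) != 0.
  by rewrite (_ : a + z%:~R = g + (z - m%:Z)%:~R) // /a; ring.
have nzA z x : x = a + z%:~R -> s x != 0 by move=> ->; apply: nza.
rewrite (_ : g - m.+1%:R = a - 1); last by rewrite /a; ring.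
rewrite (_ : 2 * m.+1 + ep = n.+2)%N; last by rewrite /n; lia.
pose N k := \prod_(i < k) K (- (3 * i%:R)).
pose D k := \prod_(l < k) K (g - l%:R).
pose al k := s (n%:R + k%:R + 1) * s (2 * n%:R - k%:R + 2)
    / (s (a + 4 * k%:R) * s (a + n%:R + 2 * k%:R + 1)).
pose be k := s (a - n%:R + 3 * k%:R - 1) * s (a + 2 * n%:R + 3 * k%:R + 2)
    / (s (a + 4 * k%:R) * s (a + n%:R + 2 * k%:R + 1)).
(* The two nodes depend on [k]: they are the next factors of the two products in the term [k], which
   therefore contributes to the terms [k.+1] and [k] of the new sum. *)
have split (k : nat) : (k <= m)%N ->
  K (g - 1 - ep%:R - 3 * m%:R)
  = al k * K (- (3 * k%:R)) + be k * K (g - (m - k)%:R).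
  move=> km; rewrite {1}/K.
  have h1 : s (a + 4 * k%:R) != 0 by apply: (@nzA (4 * k%:Z)); ring.
  have h2 : s (a + n%:R + 2 * k%:R + 1) != 0.
    by apply: (@nzA (n%:Z + 2 * k%:Z + 1)); ring.
  have e1 : - (3 * k%:R) - (g - (m - k)%:R) = - (a + 4 * k%:R).
    by rewrite natrB // aE; ring.
  have e2 : - (3 * k%:R) + (g - (m - k)%:R) - (2 * g + 1 + ep%:R)
      = - (a + n%:R + 2 * k%:R + 1) by rewrite natrB // nE aE; ring.
  have e3 : g - 1 - ep%:R - 3 * m%:R - (g - (m - k)%:R) = - (n%:R + k%:R + 1).
    by rewrite natrB // nE; ring.
  have e4 : g - 1 - ep%:R - 3 * m%:R + (g - (m - k)%:R) - (2 * g + 1 + ep%:R)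
      = - (2 * n%:R - k%:R + 2) by rewrite natrB // nE; ring.
  have e5 : g - 1 - ep%:R - 3 * m%:R - (- (3 * k%:R)) = a - n%:R + 3 * k%:R - 1.
    by rewrite nE aE; ring.
  have e6 : g - 1 - ep%:R - 3 * m%:R + (- (3 * k%:R)) - (2 * g + 1 + ep%:R)
      = - (a + 2 * n%:R + 3 * k%:R + 2) by rewrite nE aE; ring.
  rewrite (@thetaS_interp _ _ (g - (m - k)%:R) (- (3 * k%:R))); last first.
    by rewrite thetaSC oppr_eq0 /thetaS e1 e2 !sN mulrNN mulf_neq0.
  rewrite -/(K _) -/(K _) /al /be; congr (_ * _ + _ * _).
    by rewrite /thetaS e1 e2 e3 e4 !sN !mulrNN.
  rewrite (thetaSC _ (- (3 * k%:R)) (g - _)) /thetaS e1 e2 e5 e6 !sN mulrNN.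
  by rewrite mulrN invrN mulrNN.
have shift0 : cubic_coef (a - 1) n.+2 0 = cubic_coef a n 0 * be 0.
  rewrite (cubic_coef_shift nza) //; congr (_ * _); rewrite /cubic_shift /be.
  rewrite !mulr0 !addr0 !subr0.
  have h1 : s a != 0 by apply: (@nzA 0); ring.
  have h2 : s (a - 1) != 0 by apply: (@nzA (-1)); ring.
  have h3 : s (a + n%:R + 1) != 0 by apply: (@nzA (n%:Z + 1)); ring.
  have h4 : s (n%:R + 1) != 0 by apply: (@odd_intr_neq0 _ n.+1%:Z); [ring|].
  have h5 : s (n%:R + 2) != 0 by apply: (@odd_intr_neq0 _ n.+2%:Z); [ring|].
  by field; rewrite h1 h2 h3 h4 h5.
have shiftS k : (k <= m)%N -> cubic_coef (a - 1) n.+2 k.+1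
    = al k * cubic_coef a n k + be k.+1 * cubic_coef a n k.+1.
  move=> km; rewrite !cubic_coefS (cubic_coef_shift nza); last by rewrite /n; lia.
  rewrite -[LHS]mulrA (cubic_pascal nza); last by rewrite /n; lia.
  rewrite mulrDr [X in X + _ = _]mulrC; congr (_ + _).
  rewrite mulrCA /be; congr (_ * _).
  rewrite (_ : a - n%:R + 3 * k.+1%:R - 1 = a - n%:R + 3 * k%:R + 2); last by ring.
  rewrite (_ : a + 2 * n%:R + 3 * k.+1%:R + 2 = a + 2 * n%:R + 3 * k%:R + 5); last by ring.
  rewrite (_ : a + 4 * k.+1%:R = a + 4 * k%:R + 4); last by ring.
  by rewrite (_ : a + n%:R + 2 * k.+1%:R + 1 = a + n%:R + 2 * k%:R + 3) //; ring.
transitivity (\sum_(k < m.+1) (al k * cubic_coef a n k * (N k.+1 * D (m - k)%N))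
   + \sum_(k < m.+1) (be k * cubic_coef a n k * (N k * D (m.+1 - k)%N))).
  rewrite -big_split /=; apply: eq_bigr => k _.
  have km : (k <= m)%N by rewrite -ltnS.
  rewrite (split k km) subSn // /N /D !big_ord_recr /=; ring.
rewrite [RHS]big_ord_recl /= subn0 shift0 /=.
rewrite [X in _ + X]big_ord_recl /= subn0 addrCA; congr (_ + _).
  by rewrite [be 0 * _]mulrC.
under [RHS]eq_bigr => k _.
  rewrite /bump /= add1n subSS shiftS -1?ltnS // mulrDl.
  over.
rewrite big_split /=; congr (_ + _).
rewrite [RHS]big_ord_recr /= {2}/cubic_coef.
(* The recursion at the top index would also involve [cubic_coef a n m.+1], which vanishes for
   [ep < 2]. *)
rewrite cubic_coefS /n (cubic_ratio_eq0 _ _ ep2) !(mulr0, mul0r) addr0.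
by apply: eq_bigr => k _; rewrite /bump /= add1n subSS.
Qed.

Lemma sfact_telescope t x k : s x * sfact t (x + t) k = sfact t x k * s (x + t * k%:R).
Proof. by rewrite -sfactSl sfactSr. Qed.

Lemma sfact_rev t x y k : y = - x - t * k%:R + t ->
  sfact t y k = (-1) ^+ k * sfact t x k.
Proof.
move=> ->; rewrite /sfact (reindex_inj rev_ord_inj) /=.
rewrite -[in (-1) ^+ k](card_ord k) -prodrN; apply: eq_bigr => i _.
by rewrite -sN natrB //; congr s; ring.
Qed.

Lemma prod_skip_last (f : nat -> F) k :
  \prod_(i < k.+1 | i != k :> nat) f i = \prod_(i < k) f i.
Proof.
rewrite big_mkcond big_ord_recr /= eqxx mulr1; apply: eq_bigr => i _.
by rewrite neq_ltn ltn_ord.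
Qed.

Lemma prod_skip_recr (f : nat -> F) k j : (j != k)%N ->
  \prod_(i < k.+1 | i != j :> nat) f i = \prod_(i < k | i != j :> nat) f i * f k.
Proof. by move=> jk; rewrite big_mkcond big_ord_recr /= -big_mkcond eq_sym jk. Qed.

(** * Lagrange coefficients for zeros [-i], nodes [a + 3j] and [d + e = a + n + 1], matched with
    cubic coefficients *)

Definition lagrange_coef (a : V) (n k j : nat) : F :=
  \prod_(i < k) thetaS (a + n%:R + 1) (- i%:R) (a + 3 * j%:R)
  / \prod_(i < k.+1 | i != j :> nat)
      thetaS (a + n%:R + 1) (a + 3 * i%:R) (a + 3 * j%:R).

Definition lhs_factor (a : V) (n k : nat) : F :=
  s (a + 4 * k%:R) / s a
  * sfact 1 (- n%:R) (2 * k) / sfact 1 (a + n%:R + 1) (2 * k).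

(** The two factorials of length [3 * j] merge the base [q^3] factorials of [q^(-n)], [q^(1-n)],
    [q^(2-n)] and those of their well-poised partners. *)
Definition rhs_factor (a : V) (n j : nat) : F :=
  s (a - n%:R - 1 + 6 * j%:R) / s (a - n%:R - 1)
  * sfact 3 (a - n%:R - 1) j / sfact 3 3 j
  * sfact 1 (- n%:R) (3 * j) / sfact 1 a (3 * j).

(** On the diagonal [k = j] the Lagrange coefficient is a quotient of factorials that continue those
    of [lhs_factor], for instance from length [2j] to [3j]; [e1] to [e5] are these splittings. *)
Lemma lagrange_cubic_coef0 (a : V) (n j : nat) :
  (forall z : int, s (a + z%:~R) != 0) -> (2 * j <= n)%N ->
  lhs_factor a n j * lagrange_coef a n j j =
  sfact 1 (a + 1) n / sfact 3 (a - n%:R + 2) n * rhs_factor a n j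
  * cubic_coef (a + 4 * j%:R) (n - 2 * j) 0.
Proof.
move=> nza jn; have nzA z x : x = a + z%:~R -> s x != 0 by move=> ->; apply: nza.
have -> : lagrange_coef a n j j = sfact 1 (a + 3 * j%:R) j * sfact 1 (- n%:R + 2 * j%:R) j
    / (sfact 3 3 j * sfact 3 (a - n%:R - 1 + 3 * j%:R) j).
  rewrite /lagrange_coef
    (prod_skip_last (fun i => thetaS _ (a + 3 * i%:R) (a + 3 * j%:R))).
  rewrite /thetaS !big_split /=.
  have -> : \prod_(i < j) s (- i%:R - (a + 3 * j%:R)) = (-1) ^+ j * sfact 1 (a + 3 * j%:R) j.
    rewrite -[in (-1) ^+ j](card_ord j) -prodrN; apply: eq_bigr => i _.
    by rewrite -sN; congr s; ring.
  have -> : \prod_(i < j) s (- i%:R + (a + 3 * j%:R) - (a + n%:R + 1))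
      = sfact 1 (- n%:R + 2 * j%:R) j.
    rewrite /sfact (reindex_inj rev_ord_inj); apply: eq_bigr => i _ /=.
    by rewrite natrB //; congr s; ring.
  have -> : \prod_(i < j) s (a + 3 * i%:R - (a + 3 * j%:R)) = (-1) ^+ j * sfact 3 3 j.
    rewrite -(@sfact_rev _ _ (- 3 * j%:R)); last by ring.
    by apply: eq_bigr => i _; congr s; ring.
  have -> : \prod_(i < j) s (a + 3 * i%:R + (a + 3 * j%:R) - (a + n%:R + 1))
      = sfact 3 (a - n%:R - 1 + 3 * j%:R) j.
    by apply: eq_bigr => i _; congr s; ring.
  have cancel (u x y z w : F) : u != 0 -> u * x * y / (u * z * w) = x * y / (z * w).
    by move=> u0; rewrite -!(mulrA u) [(u * _)^-1]invfM [x * y * _]mulrCA mulVKf.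
  by apply: cancel; rewrite signr_eq0.
rewrite /lhs_factor /rhs_factor /cubic_coef big_ord0 mulr1 natrB //.
rewrite (_ : a + 4 * j%:R - (n%:R - (2 * j)%:R) + 2 = a - n%:R + 2 + 3 * (2 * j)%:R);
  last by ring.
have e1 : sfact 1 (- n%:R) (3 * j) = sfact 1 (- n%:R) (2 * j) * sfact 1 (- n%:R + 2 * j%:R) j.
  rewrite (_ : 3 * j = 2 * j + j)%N; last by ring.
  by rewrite sfactD; congr (_ * sfact _ _ _); ring.
have e2 : s a * sfact 1 (a + 1) (4 * j)
    = sfact 1 a (3 * j) * sfact 1 (a + 3 * j%:R) j * s (a + 4 * j%:R).
  rewrite sfact_telescope (_ : 4 * j = 3 * j + j)%N; last by ring.
  by rewrite sfactD; congr (_ * sfact _ _ _ * s _); ring.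
have e3 : sfact 1 (a + 1) n * sfact 1 (a + n%:R + 1) (2 * j)
    = sfact 1 (a + 1) (4 * j) * sfact 1 (a + 4 * j%:R + 1) (n - 2 * j).
  transitivity (sfact 1 (a + 1) (n + 2 * j)).
    by rewrite sfactD; congr (_ * sfact _ _ _); ring.
  rewrite (_ : n + 2 * j = 4 * j + (n - 2 * j))%N; last by move: jn; clear; lia.
  by rewrite sfactD; congr (_ * sfact _ _ _); ring.
have e4 : sfact 3 (a - n%:R + 2) n
    = sfact 3 (a - n%:R + 2) (2 * j) * sfact 3 (a - n%:R + 2 + 3 * (2 * j)%:R) (n - 2 * j).
  by rewrite -sfactD subnKC.
have e5 : s (a - n%:R - 1) * sfact 3 (a - n%:R + 2) (2 * j)
    = sfact 3 (a - n%:R - 1) j * sfact 3 (a - n%:R - 1 + 3 * j%:R) j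
      * s (a - n%:R - 1 + 6 * j%:R).
  rewrite (_ : a - n%:R + 2 = a - n%:R - 1 + 3); last by ring.
  rewrite sfact_telescope (_ : 2 * j = j + j)%N; last by ring.
  by rewrite sfactD; congr (_ * _ * s _); ring.
have h1 : s a != 0 by apply: (@nzA 0); ring.
have h2 : s (a - n%:R - 1) != 0 by apply: (@nzA (- n%:Z - 1)); ring.
have h3 : s (a - n%:R - 1 + 6 * j%:R) != 0 by apply: (@nzA (6 * j%:Z - n%:Z - 1)); ring.
have h4 : sfact 1 (a + n%:R + 1) (2 * j) != 0.
  by apply: sfact_neq0 => i _; apply: (@nzA (n%:Z + 1 + i%:Z)); ring.
have h5 : sfact 3 3 j != 0.
  by apply: sfact_neq0 => i _; apply: (@odd_intr_neq0 _ (3 * i.+1%:Z)); [ring|].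
have h6 : sfact 1 a (3 * j) != 0.
  by apply: sfact_neq0 => i _; apply: (@nzA (i%:Z)); ring.
have h7 : sfact 3 (a - n%:R - 1) j != 0.
  by apply: sfact_neq0 => i _; apply: (@nzA (3 * i%:Z - n%:Z - 1)); ring.
have h8 : sfact 3 (a - n%:R - 1 + 3 * j%:R) j != 0.
  by apply: sfact_neq0 => i _; apply: (@nzA (3 * i%:Z + 3 * j%:Z - n%:Z - 1)); ring.
have h9 : sfact 1 (a + 4 * j%:R + 1) (n - 2 * j) != 0.
  by apply: sfact_neq0 => i _; apply: (@nzA (4 * j%:Z + 1 + i%:Z)); ring.
have h10 : sfact 3 (a - n%:R + 2 + 3 * (2 * j)%:R) (n - 2 * j) != 0.
  by apply: sfact_neq0 => i _; apply: (@nzA (3 * (2 * j%:Z) + 2 - n%:Z + 3 * i%:Z)); ring.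
have {}e3 : sfact 1 (a + 1) n = sfact 1 (a + 1) (4 * j)
    * sfact 1 (a + 4 * j%:R + 1) (n - 2 * j) / sfact 1 (a + n%:R + 1) (2 * j).
  by rewrite -e3 mulfK.
have {}e2 : sfact 1 (a + 1) (4 * j)
  = sfact 1 a (3 * j) * sfact 1 (a + 3 * j%:R) j * s (a + 4 * j%:R) / s a.
  by rewrite -e2 mulrC mulKf.
have {}e5 : sfact 3 (a - n%:R + 2) (2 * j)
    = sfact 3 (a - n%:R - 1) j * sfact 3 (a - n%:R - 1 + 3 * j%:R) j
      * s (a - n%:R - 1 + 6 * j%:R) / s (a - n%:R - 1).
  by rewrite -e5 mulrC mulKf.
rewrite e1 e3 e2 e4 e5.
by field; rewrite h1 h2 h3 h4 h5 h6 h7 h8 h9 h10.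
Qed.

(** A step in [i] multiplies the left side by [cubic_ratio (a + 4j) (n - 2j) i], which is the source
    of the shifted parameters: [lhs_factor] supplies its first two quotients, the new zero and the
    new node of [lagrange_coef] the third. *)
Lemma lagrange_cubic_coef (a : V) (n j i : nat) :
  (forall z : int, s (a + z%:~R) != 0) -> (2 * (j + i) <= n)%N ->
  lhs_factor a n (j + i) * lagrange_coef a n (j + i) j =
  sfact 1 (a + 1) n / sfact 3 (a - n%:R + 2) n * rhs_factor a n j
  * cubic_coef (a + 4 * j%:R) (n - 2 * j) i.
Proof.
move=> nza; have nzA z x : x = a + z%:~R -> s x != 0 by move=> ->; apply: nza.
elim: i => [|i IH] ijn; first by rewrite addn0 in ijn *; apply: lagrange_cubic_coef0.
have ijn' : (2 * (j + i) <= n)%N by move: ijn; clear; lia.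
rewrite cubic_coefS mulrA -IH // addnS; set k := (j + i)%N.
have kE : k%:R = j%:R + i%:R :> V by rewrite /k natrD.
rewrite natrB; last by move: ijn'; clear; lia.
have jk : (j != k.+1) by rewrite /k; clear; lia.
rewrite /lhs_factor /lagrange_coef mulnS addnC addn2 !sfactSr big_ord_recr /=.
rewrite (prod_skip_recr (fun i => thetaS _ (a + 3 * i%:R) (a + 3 * j%:R)) jk).
set U := \prod_(_ < _) _; set W := \prod_(_ < _ | _) _.
rewrite /thetaS /cubic_ratio.
rewrite (_ : a + 4 * j%:R + 4 * i%:R + 4 = a + 4 * k.+1%:R); last by ring: kE.
rewrite (_ : a + 4 * j%:R + 4 * i%:R = a + 4 * k%:R); last by ring: kE.
rewrite (_ : n%:R - (2 * j)%:R - 2 * i%:R - 1 = n%:R - 2 * k%:R - 1); last by ring: kE.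
rewrite (_ : n%:R - (2 * j)%:R - 2 * i%:R = n%:R - 2 * k%:R); last by ring: kE.
rewrite (_ : a + 4 * j%:R + (n%:R - (2 * j)%:R) + 2 * i%:R + 1 = a + n%:R + 2 * k%:R + 1);
  last by ring: kE.
rewrite (_ : a + 4 * j%:R + (n%:R - (2 * j)%:R) + 2 * i%:R + 2 = a + n%:R + 2 * k%:R + 2);
  last by ring: kE.
rewrite (_ : a + 4 * j%:R + i%:R = a + k%:R + 3 * j%:R); last by ring: kE.
rewrite (_ : n%:R - (2 * j)%:R + i%:R + 1 = n%:R + k%:R - 3 * j%:R + 1); last by ring: kE.
rewrite (_ : 3 * i%:R + 3 = 3 * k%:R - 3 * j%:R + 3); last by ring: kE.
rewrite (_ : a + 4 * j%:R - (n%:R - (2 * j)%:R) + 3 * i%:R + 2 = a - n%:R + 3 * k%:R + 3 * j%:R + 2);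
  last by ring: kE.
rewrite (_ : - n%:R + 1 * (2 * k)%:R = - (n%:R - 2 * k%:R)); last by ring.
rewrite (_ : - n%:R + 1 * (2 * k).+1%:R = - (n%:R - 2 * k%:R - 1)); last by ring.
rewrite (_ : a + n%:R + 1 + 1 * (2 * k)%:R = a + n%:R + 2 * k%:R + 1); last by ring.
rewrite (_ : a + n%:R + 1 + 1 * (2 * k).+1%:R = a + n%:R + 2 * k%:R + 2); last by ring.
rewrite (_ : - k%:R - (a + 3 * j%:R) = - (a + k%:R + 3 * j%:R)); last by ring.
rewrite (_ : - k%:R + (a + 3 * j%:R) - (a + n%:R + 1) = - (n%:R + k%:R - 3 * j%:R + 1));
  last by ring.
rewrite (_ : a + 3 * k.+1%:R - (a + 3 * j%:R) = 3 * k%:R - 3 * j%:R + 3); last by ring.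
rewrite (_ : a + 3 * k.+1%:R + (a + 3 * j%:R) - (a + n%:R + 1) = a - n%:R + 3 * k%:R + 3 * j%:R + 2);
  last by ring.
rewrite !sN.
have h1 : s a != 0 by apply: (@nzA 0); ring.
have h2 : s (a + 4 * k%:R) != 0 by apply: (@nzA (4 * k%:Z)); ring.
have h3 : s (a + n%:R + 2 * k%:R + 1) != 0 by apply: (@nzA (n%:Z + 2 * k%:Z + 1)); ring.
have h4 : s (a + n%:R + 2 * k%:R + 2) != 0 by apply: (@nzA (n%:Z + 2 * k%:Z + 2)); ring.
have h5 : s (a - n%:R + 3 * k%:R + 3 * j%:R + 2) != 0.
  by apply: (@nzA (3 * k%:Z + 3 * j%:Z + 2 - n%:Z)); ring.
have h6 : s (3 * k%:R - 3 * j%:R + 3) != 0.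
  by apply: (@odd_intr_neq0 _ (3 * i.+1%:Z)); [rewrite kE; ring|].
have h7 : sfact 1 (a + n%:R + 1) (2 * k) != 0.
  by apply: sfact_neq0 => l _; apply: (@nzA (n%:Z + 1 + l%:Z)); ring.
have h8 : W != 0.
  apply/prodf_neq0 => l lj; rewrite /thetaS mulf_neq0 //.
    apply: (@odd_intr_neq0 _ (3 * (l%:Z - j%:Z))); first by ring.
    by rewrite mulf_eq0 subr_eq0.
  by apply: (@nzA (3 * l%:Z + 3 * j%:Z - n%:Z - 1)); ring.
by field; rewrite h1 h2 h3 h4 h5 h6 h7 h8.
Qed.

Lemma sum_triangle (f : nat -> nat -> F) M :
  \sum_(k < M) \sum_(j < k.+1) f k j = \sum_(j < M) \sum_(i < M - j) f (j + i)%N j.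
Proof.
elim: M => [|M IH]; first by rewrite !big_ord0.
rewrite big_ord_recr /= IH [RHS]big_ord_recr /= subSnn big_ord1 addn0.
rewrite [\sum_(j < M.+1) f M j]big_ord_recr /= addrA; congr (_ + _).
rewrite -big_split /=; apply: eq_bigr => j _.
have jM : (j <= M)%N by rewrite ltnW.
by rewrite subSn // big_ord_recr /= subnKC.
Qed.

Lemma prod_rev_split (f : nat -> F) k m : (k <= m)%N ->
  \prod_(i < k) f i * \prod_(l < m - k) f (m.-1 - l)%N = \prod_(i < m) f i.
Proof.
move=> km; rewrite -[in RHS](subnKC km) big_split_ord /=; congr (_ * _).
rewrite (reindex_inj rev_ord_inj); apply: eq_bigr => l _ /=; congr f.
by have := ltn_ord l; lia.
Qed.

(** * Expansions of the factors in [b], [c] and of the factors in [d], [e] *)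

Definition bpart_lhs (a b c : V) (k : nat) : F :=
  sfact 3 b k * sfact 3 c k / (sfact 1 (a - b + 1) k * sfact 1 (a - c + 1) k).

Lemma thetaS_pair (beta x b c : V) : c = beta - b -> thetaS beta x b = s (x - b) * s (x - c).
Proof. by move=> ->; rewrite /thetaS; congr (_ * s _); ring. Qed.

Lemma thetaS_prod_neg (beta b c : V) k : c = beta - b ->
  \prod_(i < k) thetaS beta (- (3 * i%:R)) b = sfact 3 b k * sfact 3 c k.
Proof.
move=> cE; rewrite /sfact -big_split; apply: eq_bigr => i _ /=.
rewrite (thetaS_pair _ cE) -[in RHS]mulrNN -!sN.
by congr (s _ * s _); ring.
Qed.

Lemma thetaS_prod_pos (beta b c x t : V) k : c = beta - b ->
  \prod_(i < k) thetaS beta (x + t * i%:R) b = sfact t (x - b) k * sfact t (x - c) k.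
Proof.
move=> cE; rewrite /sfact -big_split; apply: eq_bigr => i _ /=.
by rewrite (thetaS_pair _ cE); congr (s _ * s _); ring.
Qed.

(** Here [beta] is the sum of the first and last points of the progression, so reversing its second
    half turns factors in [b] into factors in [c]. A product in [b] alone thus becomes a product of
    [thetaS], with a middle factor when [ep = 1]. *)
Lemma sfact_half (beta b c x t : V) (ep m : nat) : (ep < 2)%N -> c = beta - b ->
  beta = 2 * x + t * (2 * m%:R + ep%:R - 1) ->
  sfact t (x - b) (2 * m + ep) =
  (-1) ^+ m * \prod_(i < m) thetaS beta (x + t * i%:R) b * s (x - b + t * m%:R) ^+ ep.
Proof.
move=> ep2 cE bE; rewrite (thetaS_prod_pos _ _ _ cE).
rewrite (_ : 2 * m + ep = m + ep + m)%N; last by clear; lia.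
rewrite sfactD sfactD (@sfact_rev t (x - c) (_ + t * (m + ep)%:R)); last first.
  by rewrite cE bE natrD; ring.
rewrite (_ : sfact _ _ ep = s (x - b + t * m%:R) ^+ ep).
  by rewrite -!mulrA; ring.
case: ep ep2 {bE} => [|[|//]] _; first by rewrite sfact0.
by rewrite sfactSr sfact0 mulr0 addr0 mul1r.
Qed.

Lemma bpart_expansion (a b c : V) (n m ep j : nat) :
  n = (2 * m + ep)%N -> (ep < 2)%N -> (j <= m)%N ->
  c = 2 * a + n%:R + 1 - b ->
  (forall z : int, s (a + z%:~R) != 0) ->
  (forall z : int, s (a - b + z%:~R) != 0) ->
  sfact 3 (a - n%:R + 2 - b) n / sfact 1 (a - b + 1) n
   * (sfact 3 b j * sfact 3 c j / (sfact 3 (a - n%:R + 2 - b) j * sfact 3 (a - n%:R + 2 - c) j))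
  = \sum_(i < m.+1 - j) cubic_coef (a + 4 * j%:R) (n - 2 * j) i * bpart_lhs a b c (j + i).
Proof.
move=> nE ep2 jm cE nza nzab.
have nnE : n%:R = 2 * m%:R + ep%:R :> V by rewrite nE; ring.
have nzAB z x : x = a - b + z%:~R -> s x != 0 by move=> ->; apply: nzab.
have nzAC z x : x = - (a - b + z%:~R) -> s x != 0.
  by move=> ->; rewrite sN oppr_eq0; apply: nzab.
set g := a + m%:R; set beta := 2 * g + 1 + ep%:R.
have cE' : c = beta - b by rewrite cE /beta /g nnE; ring.
pose K x := thetaS beta x b.
pose f i := K (a + 1 + 1 * i%:R).
pose h i := K (a - n%:R + 2 + 3 * i%:R).
have fnz k : \prod_(i < k) f i != 0.
  apply/prodf_neq0 => i _; rewrite /f /K (thetaS_pair _ cE') mulf_neq0 //.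
    by apply: (@nzAB (1 + i%:Z)); ring.
  by rewrite cE; apply: (@nzAC (n%:Z - i%:Z)); ring.
have hnz k : \prod_(i < k) h i != 0.
  apply/prodf_neq0 => i _; rewrite /h /K (thetaS_pair _ cE') mulf_neq0 //.
    by apply: (@nzAB (3 * i%:Z + 2 - n%:Z)); ring.
  by rewrite cE; apply: (@nzAC (2 * n%:Z - 1 - 3 * i%:Z)); ring.
(* Both progressions are symmetric about the same point, so [sfact_half] applies to both with the
   same [beta]; for [ep = 1] the middle factors agree and cancel. *)
have -> : sfact 3 (a - n%:R + 2 - b) n / sfact 1 (a - b + 1) n
    = \prod_(i < m) h i / \prod_(i < m) f i.
  rewrite nE (@sfact_half beta _ c) //; last by rewrite /beta /g; ring.
  rewrite (_ : a - b + 1 = a + 1 - b); last by ring.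
  rewrite (@sfact_half beta _ c) //; last by rewrite /beta /g; ring.
  rewrite (_ : a - (2 * m + ep)%:R + 2 - b + 3 * m%:R = a + 1 - b + m%:R + 1 - ep%:R);
    last by ring.
  rewrite -nE -/h -/f.
  have sgn : (-1) ^+ m != 0 :> F by rewrite signr_eq0.
  move: (fnz m); rewrite /f /h -/K => fm.
  case: ep ep2 @beta @K {f h fnz hnz} cE' nE nnE fm => [|[|//]] _ beta cE' K nE nnE fm.
    by rewrite !expr0 !mulr1; field; rewrite fm sgn.
  rewrite !expr1 (_ : a + 1 - b + m%:R + 1 - 1%:R = a + 1 - b + 1 * m%:R); last by ring.
  have nz : s (a + 1 - b + 1 * m%:R) != 0 by apply: (@nzAB (1 + m%:Z)); ring.
  by field; rewrite fm sgn nz.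
have -> : sfact 3 (a - n%:R + 2 - b) j * sfact 3 (a - n%:R + 2 - c) j = \prod_(i < j) h i.
  by rewrite -(thetaS_prod_pos _ _ _ cE').
have blE k : bpart_lhs a b c k = \prod_(i < k) K (- (3 * i%:R)) / \prod_(i < k) f i.
  rewrite /bpart_lhs -(thetaS_prod_neg _ cE') /f /K (thetaS_prod_pos _ _ _ cE').
  by congr (_ / (sfact _ _ _ * sfact _ _ _)); ring.
rewrite -(thetaS_prod_neg _ cE') -/K -(prod_rev_split h jm).
have := @cubic_expansion ep (m - j) (g + 3 * j%:R) (b + 3 * j%:R) ep2.
have nzg' z : s (g + 3 * j%:R + z%:~R) != 0.
  rewrite (_ : _ + _ = a + (m%:Z + 3 * j%:Z + z)%:~R); first exact: nza.
  by rewrite /g; ring.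
move=> /(_ nzg') /= H.
have predE l : (l < m)%N -> (m.-1 - l)%:R = m%:R - l%:R - 1 :> V.
  by move=> lm; rewrite -subn1 -subnDA natrB ?add1n // -natr1; ring.
(* The shift of [g] raises [beta] by [6j], which with the shift of [b] is only a translation of the
   argument. *)
have KE x : thetaS (2 * (g + 3 * j%:R) + 1 + ep%:R) x (b + 3 * j%:R) = K (x - 3 * j%:R).
  by rewrite /K /thetaS; congr (s _ * s _); rewrite /beta; ring.
have {H} -> : \prod_(l < m - j) h (m.-1 - l)%N =
    \sum_(i < (m - j).+1) cubic_coef (a + 4 * j%:R) (n - 2 * j) i *
     (\prod_(l < i) K (- (3 * (j + l)%:R)) * \prod_(l < m - (j + i)) f (m.-1 - l)%N).
  transitivity (\prod_(l < m - j) K (g - 1 - ep%:R - 3 * l%:R)).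
    apply: eq_bigr => l _; rewrite /h; congr K.
    have lm : (l < m)%N by apply: leq_trans (ltn_ord l) _; apply: leq_subr.
    by rewrite predE // nnE /g; ring.
  move: H; under eq_bigr => l _ do rewrite KE.
  under [in X in _ = X]eq_bigr => i _.
    under eq_bigr => l _ do rewrite KE.
    under [X in _ * (_ * X)]eq_bigr => l _ do rewrite KE.
    over.
  rewrite (_ : g + 3 * j%:R - (m - j)%:R = a + 4 * j%:R); last first.
    by rewrite natrB // /g; ring.
  rewrite (_ : 2 * (m - j) + ep = n - 2 * j)%N; last by move: nE jm; clear; lia.
  move=> H; rewrite (eq_bigr (fun l : 'I_(m - j) =>
    K (g + 3 * j%:R - 1 - ep%:R - 3 * l%:R - 3 * j%:R))); last first.
    by move=> l _; congr K; ring.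
  rewrite H; apply: eq_bigr => i _; congr (_ * (_ * _)).
    by apply: eq_bigr => l _; congr K; ring.
  rewrite subnDA; apply: eq_bigr => l _; rewrite /f; congr K.
  have lm : (l < m)%N.
    by apply: leq_trans (ltn_ord l) _; rewrite -subnDA leq_subr.
  by rewrite predE // /g; ring.
rewrite subSn //; set S := \sum_(_ < _) _.
transitivity (S * (\prod_(i < j) K (- (3 * i%:R)) / \prod_(i < m) f i)).
  by rewrite -/K; field; rewrite fnz hnz.
rewrite mulr_suml; apply: eq_bigr => i _; rewrite -mulrA; congr (_ * _).
have jim : (j + i <= m)%N by move: (ltn_ord i) jm; clear; lia.
rewrite blE -(prod_rev_split f jim) [in RHS]big_split_ord /=.
have nz1 := fnz (j + i)%N.
have nz2 : \prod_(l < m - (j + i)) f (m.-1 - l)%N != 0.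
  by have := fnz m; rewrite -(prod_rev_split f jim) mulf_eq0 negb_or => /andP[].
by field; rewrite nz1 nz2.
Qed.

(** The zeros [-i] give the numerator and the nodes after the first the denominator. A basis product
    over that denominator equals [thetaS beta (x 0) d / thetaS beta (x j) d], free of [k], and
    unfolds to a telescoping quotient of length [j]. *)
Lemma dpart_expansion (a d e : V) (n k : nat) : e = a + n%:R + 1 - d ->
  (forall z : int, s (a + z%:~R) != 0) ->
  (forall z : int, s (d + z%:~R) != 0) ->
  (forall z : int, s (a - d + z%:~R) != 0) ->
  sfact 1 d k * sfact 1 e k / (sfact 3 (a - d + 3) k * sfact 3 (a - e + 3) k) =
  \sum_(j < k.+1) lagrange_coef a n k j *
    (sfact 3 (a - d) j * sfact 3 (a - e) j
     / (sfact 3 (a - d + 3) j * sfact 3 (a - e + 3) j)).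
Proof.
move=> eE nza nzd nzad.
have nzA z x : x = a + z%:~R -> s x != 0 by move=> ->; apply: nza.
have nzD z x : x = d + z%:~R -> s x != 0 by move=> ->; apply: nzd.
have nzAD z x : x = a - d + z%:~R -> s x != 0 by move=> ->; apply: nzad.
set beta := a + n%:R + 1.
pose x j : V := a + 3 * j%:R.
have xnz i j : i != j -> thetaS beta (x i) (x j) != 0.
  move=> ij; rewrite /thetaS mulf_neq0 //.
    apply: (@odd_intr_neq0 _ (3 * (i%:Z - j%:Z))); first by rewrite /x; ring.
    by rewrite mulf_eq0 subr_eq0.
  by apply: (@nzA (3 * i%:Z + 3 * j%:Z - n%:Z - 1)); rewrite /x /beta; ring.
have Knz j : thetaS beta (x j) d != 0.
  rewrite (thetaS_pair _ eE) /x mulf_neq0 //.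
    by apply: (@nzAD (3 * j%:Z)); ring.
  by apply: (@nzD (3 * j%:Z - n%:Z - 1)); rewrite eE; ring.
have -> : sfact 1 d k * sfact 1 e k = \prod_(i < k) thetaS beta (- i%:R) d.
  rewrite /sfact -big_split; apply: eq_bigr => i _ /=.
  by rewrite (thetaS_pair _ eE) -[LHS]mulrNN -!sN; congr (s _ * s _); ring.
rewrite (lagrange_thetaS (fun i => - i%:R) d k xnz) mulr_suml.
apply: eq_bigr => j _; rewrite /lagrange_coef -/beta -mulrA; congr (_ * _).
have prodE l : \prod_(i < l) thetaS beta (x i.+1) d
    = sfact 3 (a - d + 3) l * sfact 3 (a - e + 3) l.
  rewrite (_ : a - d + 3 = a + 3 - d); last by ring.
  rewrite (_ : a - e + 3 = a + 3 - e); last by ring.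
  rewrite -(thetaS_prod_pos _ _ _ eE).
  by apply: eq_bigr => i _; congr thetaS; rewrite /x; ring.
have prodE0 l : \prod_(i < l) thetaS beta (x i) d = sfact 3 (a - d) l * sfact 3 (a - e) l.
  by rewrite -(thetaS_prod_pos _ _ _ eE).
have prodnz l : \prod_(i < l) thetaS beta (x i.+1) d != 0 by apply/prodf_neq0.
rewrite -!prodE -prodE0.
have tele l : \prod_(i < l) thetaS beta (x i) d * thetaS beta (x l) d
    = thetaS beta (x 0) d * \prod_(i < l) thetaS beta (x i.+1) d.
  rewrite -[LHS](big_ord_recr l (fun i => thetaS beta (x i) d)) big_ord_recl.
  by congr (_ * _); apply: eq_bigr => i _; rewrite /bump add1n.
have -> : \prod_(i < j) thetaS beta (x i) d
    = thetaS beta (x 0) d * \prod_(i < j) thetaS beta (x i.+1) d / thetaS beta (x j) d.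
  by rewrite -tele mulfK.
have skip : \prod_(i < k.+1 | i != j) thetaS beta (x i) d * thetaS beta (x j) d
    = thetaS beta (x 0) d * \prod_(i < k) thetaS beta (x i.+1) d.
  by rewrite -tele -[RHS](big_ord_recr k (fun i => thetaS beta (x i) d)) [RHS](bigD1 j) //= mulrC.
have -> : \prod_(i < k.+1 | i != j) thetaS beta (x i) d
    = thetaS beta (x 0) d * \prod_(i < k) thetaS beta (x i.+1) d / thetaS beta (x j) d.
  by rewrite -skip mulfK.
by field; rewrite (prodnz j) (prodnz k) (Knz j).
Qed.

Lemma rhs_factor_eq0 a n j : (n < 3 * j)%N -> rhs_factor a n j = 0.
Proof.
move=> nj; rewrite /rhs_factor /sfact [X in _ * X / _](bigD1 (Ordinal nj)) //=.
by rewrite mul1r addNr s0 !(mul0r, mulr0).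
Qed.

Theorem additive_cubic_transformation (a b c d e : V) (n : nat) :
  c = 2 * a + n%:R + 1 - b -> e = a + n%:R + 1 - d ->
  (forall z : int, s (a + z%:~R) != 0) ->
  (forall z : int, s (a - b + z%:~R) != 0) ->
  (forall z : int, s (d + z%:~R) != 0) ->
  (forall z : int, s (a - d + z%:~R) != 0) ->
  \sum_(k < (n %/ 2).+1) lhs_factor a n k * bpart_lhs a b c k
    * (sfact 1 d k * sfact 1 e k / (sfact 3 (a - d + 3) k * sfact 3 (a - e + 3) k))
  = sfact 1 (a + 1) n / sfact 3 (a - n%:R + 2) n
    * (sfact 3 (a - n%:R + 2 - b) n / sfact 1 (a - b + 1) n)
    * \sum_(j < (n %/ 3).+1) rhs_factor a n j
      * (sfact 3 b j * sfact 3 c j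
         / (sfact 3 (a - n%:R + 2 - b) j * sfact 3 (a - n%:R + 2 - c) j))
      * (sfact 3 (a - d) j * sfact 3 (a - e) j
         / (sfact 3 (a - d + 3) j * sfact 3 (a - e + 3) j)).
Proof.
move=> cE eE nza nzab nzd nzad.
set m := (n %/ 2)%N.
have [ep ep2 nE] : exists2 ep, (ep < 2)%N & n = (2 * m + ep)%N.
  by exists (n %% 2)%N; rewrite ?ltn_mod // mulnC -divn_eq.
set dz := fun j : nat => sfact 3 (a - d) j * sfact 3 (a - e) j
  / (sfact 3 (a - d + 3) j * sfact 3 (a - e + 3) j).
set bz := fun j : nat => sfact 3 b j * sfact 3 c j
  / (sfact 3 (a - n%:R + 2 - b) j * sfact 3 (a - n%:R + 2 - c) j).
(* Past [n / 3] the terms vanish; extending the range to [n / 2] produces the triangle needed for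
   the exchange of sums. *)
have -> : \sum_(j < (n %/ 3).+1) rhs_factor a n j * bz j * dz j
    = \sum_(j < m.+1) rhs_factor a n j * bz j * dz j.
  have n32 : ((n %/ 3).+1 <= m.+1)%N by rewrite ltnS leq_div2l.
  rewrite (big_ord_widen _ (fun j => rhs_factor a n j * bz j * dz j) n32).
  rewrite big_mkcond; apply: eq_bigr => j _; case: ltnP => // nj.
  by rewrite rhs_factor_eq0 ?mul0r // mulnC -ltn_divLR.
transitivity (\sum_(k < m.+1) \sum_(j < k.+1)
    lhs_factor a n k * bpart_lhs a b c k * (lagrange_coef a n k j * dz j)).
  by apply: eq_bigr => k _; rewrite (dpart_expansion k eE) // mulr_sumr.
rewrite (sum_triangle (fun k j =>
  lhs_factor a n k * bpart_lhs a b c k * (lagrange_coef a n k j * dz j))).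
rewrite mulr_sumr; apply: eq_bigr => j _.
have jm : (j <= m)%N by rewrite -ltnS.
have H := bpart_expansion nE ep2 jm cE nza nzab.
transitivity (sfact 1 (a + 1) n / sfact 3 (a - n%:R + 2) n * rhs_factor a n j * dz j *
  (sfact 3 (a - n%:R + 2 - b) n / sfact 1 (a - b + 1) n * bz j)); last by ring.
rewrite H mulr_sumr; apply: eq_bigr => i _.
have ijn : (2 * (j + i) <= n)%N.
  by move: (ltn_ord i) jm nE; clear; lia.
have := lagrange_cubic_coef nza ijn => {}H.
transitivity (lhs_factor a n (j + i) * lagrange_coef a n (j + i) j
  * (bpart_lhs a b c (j + i) * dz j)); first by ring.
by rewrite H; ring.
Qed.
End OddFunction.

(** * Moduli and limits of complex sequences *)

Section ComplexModulus.
Variable R : realType.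
Implicit Types (z w : CC R) (u v : nat -> CC R).

(** The norm of [CC R] takes values in [CC R]; this is the same number in [R], where the total order
    and the series criteria are available. *)
Definition modc z : R := complex.Re `|z|.

Lemma modcE z : `|z| = (modc z)%:C%C :> CC R.
Proof.
by rewrite /modc RRe_real // normr_real.
Qed.

Lemma modc_ge0 z : 0 <= modc z.
Proof. by rewrite -ler0c -modcE. Qed.

Lemma modcM z w : modc (z * w) = modc z * modc w.
Proof. by apply: complexI; rewrite rmorphM -!modcE normrM. Qed.

Lemma modcD z w : modc (z + w) <= modc z + modc w.
Proof. by rewrite -lecR rmorphD -!modcE ler_normD. Qed.

Lemma modcN z : modc (- z) = modc z.
Proof. by apply: complexI; rewrite -!modcE normrN. Qed.

Lemma modcB z w : modc (z - w) <= modc z + modc w.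
Proof. by rewrite -(modcN w) modcD. Qed.

Lemma modc1 : modc 1 = 1.
Proof. by apply: complexI; rewrite -!modcE normr1. Qed.

Lemma modc0 : modc 0 = 0.
Proof. by apply: complexI; rewrite -!modcE normr0. Qed.

Lemma modc_eq0 z : (modc z == 0) = (z == 0).
Proof. by rewrite -(inj_eq (@complexI R)) -modcE normr_eq0. Qed.

Lemma modc_gt0 z : (0 < modc z) = (z != 0).
Proof. by rewrite lt_def modc_ge0 andbT modc_eq0. Qed.

Lemma modcX z n : modc (z ^+ n) = modc z ^+ n.
Proof. by elim: n => [|n IH]; rewrite ?expr0 ?modc1 // !exprS modcM IH. Qed.

Lemma modcV z : modc z^-1 = (modc z)^-1.
Proof.
have [->|z0] := eqVneq z 0; first by rewrite invr0 modc0 invr0.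
apply: (mulIf (_ : modc z != 0)); first by rewrite modc_eq0.
by rewrite -modcM !mulVf ?modc1 ?modc_eq0.
Qed.

Lemma modc_prod n (f : nat -> CC R) :
  modc (\prod_(i < n) f i) = \prod_(i < n) modc (f i).
Proof. by elim: n => [|n IH]; rewrite ?big_ord0 ?modc1 // !big_ord_recr /= modcM IH. Qed.

Lemma modc_lt1 z : `|z| < 1 -> modc z < 1.
Proof. by rewrite modcE -[1]/((1 : R)%:C%C) ltcR. Qed.

Lemma modc_realC (x : R) : 0 <= x -> modc (x%:C%C) = x.
Proof. by move=> x0; apply: complexI; rewrite -modcE ger0_norm // ler0c. Qed.

Lemma cvg_modcP u z : (u @ \oo --> z)%classic <->
  (forall e : R, 0 < e -> exists N, forall n, (N <= n)%N -> modc (u n - z) < e).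
Proof.
split=> [/cvgrPdist_lt H e e0|H].
  have /H[N _ HN] : 0 < e%:C%C :> CC R by rewrite ltcR.
  exists N => n Nn; rewrite -ltcR -modcE distrC; exact: HN.
apply/cvgrPdist_lt => e e0.
have eE : e = (complex.Re e)%:C%C by rewrite RRe_real // gtr0_real.
have e0' : 0 < complex.Re e by rewrite -ltcR -eE.
have [N HN] := H _ e0'.
exists N => // n Nn; rewrite eE distrC modcE ltcR; exact: HN.
Qed.

Lemma cvg_const_eq (u : nat -> CC R) (z w : CC R) :
  (u @ \oo --> z)%classic -> (forall n, u n = w) -> z = w.
Proof.
move=> /cvg_modcP H uw; apply/eqP; rewrite -subr_eq0 -modc_eq0 eq_le modc_ge0 andbT.
apply/ler_addgt0Pl => e e0; have [N HN] := H e e0.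
by rewrite addr0 -modcN opprB -(uw N); apply/ltW/HN.
Qed.

Lemma cvg_modc0 u : (modc \o u @ \oo --> (0 : R))%classic -> (u @ \oo --> (0 : CC R))%classic.
Proof.
move=> /cvgrPdist_lt H; apply/cvg_modcP => e e0.
have [N _ HN] := H e e0; exists N => n Nn.
have := HN n Nn; rewrite /= subr0 sub0r normrN ger0_norm ?modc_ge0 //.
Qed.

(** The sequence is its first value plus a telescoping series, which a geometric series
    dominates. *)
Lemma geometric_increment_cvgR (v : nat -> R) (D r : R) : 0 <= r < 1 ->
  (forall n, `|v n.+1 - v n| <= D * r ^+ n) -> cvgn v.
Proof.
move=> /andP[r0 r1] H.
have D0 : 0 <= D by have := H 0; rewrite expr0 mulr1; apply: le_trans.
have cs : cvgn (series (fun n => v n.+1 - v n)).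
  apply: normed_cvg; apply: (@series_le_cvg _ _ (geometric D r)).
  - by move=> n; rewrite normr_ge0.
  - by move=> n; rewrite /geometric /= mulr_ge0 // exprn_ge0.
  - by move=> n; exact: H.
  - by apply: is_cvg_geometric_series; rewrite ger0_norm.
have -> : v = (fun n => v 0 + series (fun n => v n.+1 - v n) n).
  by apply/funext => n; rewrite /series /= telescope_sumr // addrC subrK.
by apply: is_cvgD => //; apply: is_cvg_cst.
Qed.

Lemma Re_le_modc z : `|complex.Re z| <= modc z.
Proof. by rewrite -lecR -modcE; apply: normc_ge_Re. Qed.

Lemma Im_le_modc z : `|complex.Im z| <= modc z.
Proof.
rewrite -[complex.Im z]opprK -ReiNIm normrN (le_trans (Re_le_modc _)) //.
rewrite modcM (_ : modc 'i%C = 1) ?mulr1 //.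
by apply: complexI; rewrite -modcE normc_def /= expr0n add0r expr1n sqrtr1.
Qed.

Lemma modc_le_ReIm z : modc z <= `|complex.Re z| + `|complex.Im z|.
Proof.
have e x : modc (x%:C%C) = `|x|.
  by apply: complexI; rewrite -modcE normc_def /= expr0n addr0 sqrtr_sqr.
rewrite {1}[z]complexE; apply: le_trans (modcD _ _) _; rewrite e modcM e.
rewrite (_ : modc 'i%C = 1) ?mul1r //.
by apply: complexI; rewrite -modcE normc_def /= expr0n add0r expr1n sqrtr1.
Qed.

Lemma geometric_increment_cvg u (D r : R) : 0 <= r < 1 ->
  (forall n, modc (u n.+1 - u n) <= D * r ^+ n) -> cvgn u.
Proof.
move=> r01 H.
have cre : cvgn (fun n => complex.Re (u n)).
  apply: (@geometric_increment_cvgR _ D r) => // n; apply: le_trans (H n).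
  by rewrite -lecR -modcE -raddfB; apply: normc_ge_Re.
have cim : cvgn (fun n => complex.Im (u n)).
  apply: (@geometric_increment_cvgR _ D r) => // n; apply: le_trans (H n).
  by rewrite -raddfB; apply: Im_le_modc.
have [la Hre] := (iffLR (cvg_ex _)) cre.
have [lb Him] := (iffLR (cvg_ex _)) cim.
apply/cvg_ex; exists (Complex la lb); apply/cvg_modcP => e e0.
have e2 : 0 < e / 2 by rewrite divr_gt0.
move/cvgrPdist_lt: Hre => /(_ _ e2)[N1 _ H1].
move/cvgrPdist_lt: Him => /(_ _ e2)[N2 _ H2].
exists (maxn N1 N2) => n; rewrite geq_max => /andP[n1 n2].
apply: le_lt_trans (modc_le_ReIm _) _; rewrite [e]splitr !raddfB /= ltrD //.
  by rewrite distrC; exact: H1.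
by rewrite distrC; exact: H2.
Qed.
End ComplexModulus.

(** * Estimates for products whose factors approach 1 geometrically *)

Section GeometricProducts.
Variable R : realType.
Implicit Types (f g : nat -> CC R).

Lemma sum_geometric_le (r : R) n : 0 <= r < 1 -> \sum_(k < n) r ^+ k <= (1 - r)^-1.
Proof.
move=> /andP[r0 r1]; have r1' : 0 < 1 - r by rewrite subr_gt0.
rewrite -[leLHS](mulfK (lt0r_neq0 r1')) ler_piMl //.
  by rewrite invr_ge0 ltW.
have : \sum_(k < n) r ^+ k * (1 - r) = 1 - r ^+ n.
  elim: n => [|n IH]; first by rewrite big_ord0 expr0 subrr.
  by rewrite big_ord_recr /= IH exprSr; ring.
rewrite -mulr_suml => ->.
by rewrite gerBl exprn_ge0.
Qed.

Lemma prod_geometric_bounded (C r : R) : 0 <= r < 1 -> 0 <= C ->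
  exists B, forall n, \prod_(k < n) (1 + C * r ^+ k) <= B.
Proof.
move=> r01 C0; exists (expR (C * (1 - r)^-1)) => n.
apply: (@le_trans _ _ (expR (C * \sum_(k < n) r ^+ k))); last first.
  by rewrite ler_expR ler_wpM2l // sum_geometric_le.
elim: n => [|n IH]; first by rewrite !big_ord0 mulr0 expR0.
rewrite !big_ord_recr /= (mulrDr C) expRD ler_pM // ?expR_ge1Dx //.
  by apply: prodr_ge0 => k _; rewrite addr_ge0 // mulr_ge0 // exprn_ge0 //; case/andP: r01.
by rewrite addr_ge0 // mulr_ge0 // exprn_ge0 //; case/andP: r01.
Qed.

(** Weierstrass inequality: [(1 - S)(1 - u)] exceeds [1 - S - u] by [S u], and when the bound is not
    positive nothing is to be shown. *)
Lemma modc_prod_ge f n : 1 - \sum_(k < n) modc (f k - 1) <= modc (\prod_(k < n) f k).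
Proof.
elim: n => [|n IH]; first by rewrite !big_ord0 subr0 modc1.
rewrite !big_ord_recr /= modcM; set S := \sum_(_ < _) _ in IH *.
set u := modc (f n - 1).
have u0 : 0 <= u by apply: modc_ge0.
have S0 : 0 <= S by apply: sumr_ge0 => k _; apply: modc_ge0.
have fu : 1 - u <= modc (f n).
  rewrite lerBlDr; have := modcD (f n) (1 - f n); rewrite addrC subrK modc1.
  by rewrite -[1 - f n]opprB modcN addrC.
have [neg|pos] := lerP (1 - (S + u)) 0.
  by apply: le_trans neg _; rewrite mulr_ge0 ?modc_ge0.
apply: (@le_trans _ _ ((1 - S) * (1 - u))); first by nra.
by rewrite ler_pM //; lra.
Qed.

Lemma modc_prod_le f (u : nat -> R) n : (forall k, modc (f k - 1) <= u k) ->
  modc (\prod_(k < n) f k) <= \prod_(k < n) (1 + u k).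
Proof.
move=> H; rewrite modc_prod; apply: ler_prod => k _; rewrite modc_ge0 /=.
have := modcD 1 (f k - 1); rewrite addrC subrK modc1 => /le_trans; apply.
by rewrite lerD2l.
Qed.

(** The factors are exchanged one at a time; each exchange costs [v k] times bounds [1 + u i] for
    the other factors. *)
Lemma modc_prodB_le f g (u v : nat -> R) n :
  (forall k, modc (f k - 1) <= u k) -> (forall k, modc (g k - 1) <= u k) ->
  (forall k, modc (f k - g k) <= v k) ->
  modc (\prod_(k < n) f k - \prod_(k < n) g k)
    <= (\sum_(k < n) v k) * \prod_(k < n) (1 + u k).
Proof.
move=> Hf Hg Hfg.
have v0 k : 0 <= v k by apply: le_trans (Hfg k); apply: modc_ge0.
have u0 k : 0 <= u k by apply: le_trans (Hf k); apply: modc_ge0.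
elim: n => [|n IH]; first by rewrite !big_ord0 subrr modc0 mul0r.
rewrite !big_ord_recr /=.
rewrite (_ : _ - _ = (\prod_(k < n) f k - \prod_(k < n) g k) * f n
   + \prod_(k < n) g k * (f n - g n)); last by ring.
apply: le_trans (modcD _ _) _; rewrite !modcM.
have fn : modc (f n) <= 1 + u n.
  by have := modc_prod_le 1 (f := fun _ => f n) (fun=> Hf n); rewrite !big_ord1.
have gn := modc_prod_le n Hg.
set P := \prod_(k < n) (1 + u k) in IH gn *.
set S := \sum_(k < n) v k in IH *.
have S0 : 0 <= S by apply: sumr_ge0.
have P0 : 0 <= P by apply: prodr_ge0 => k _; rewrite addr_ge0.
apply: (@le_trans _ _ (S * P * (1 + u n) + P * v n)).
  by rewrite lerD // ler_pM ?modc_ge0.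
rewrite -subr_ge0 (_ : _ - _ = P * v n * u n); last by ring.
by rewrite !mulr_ge0.
Qed.

Lemma geometric_small (C r e : R) : 0 <= r < 1 -> 0 < e ->
  exists K, forall n, (K <= n)%N -> `|C * r ^+ n| < e.
Proof.
move=> /andP[r0 r1] e0.
have : ((fun n => C * r ^+ n) @ \oo --> C * 0)%classic.
  by apply: cvgM; [exact: cvg_cst|apply: cvg_expr; rewrite ger0_norm].
move/cvgrPdist_lt => /(_ _ e0)[K _ HK]; exists K => n Kn.
by have := HK n Kn; rewrite /= mulr0 sub0r normrN.
Qed.

End GeometricProducts.

(** * The modified theta function *)

Section Theta.
Variables (R : realType) (p : CC R).
Hypothesis p1 : `|p| < 1.
Implicit Types x y : CC R.

Definition Efac x (k : nat) : CC R := (1 - x * p ^+ k) * (1 - p ^+ k.+1 / x).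
Definition Epart x (N : nat) : CC R := \prod_(k < N) Efac x k.
Let r := modc p.

Let r01 : 0 <= r < 1.
Proof. by rewrite modc_ge0 modc_lt1. Qed.
Let r0 : 0 <= r. Proof. by case/andP: r01. Qed.
Let rk0 k : 0 <= r ^+ k. Proof. by rewrite exprn_ge0. Qed.
Let rk1 k : r ^+ k <= 1.
Proof. by rewrite exprn_ile1 //; case/andP: r01 => // _ /ltW. Qed.

Definition Ebound x : R := modc x + (modc x)^-1 + 1.

Lemma Ebound_ge0 x : 0 <= Ebound x.
Proof. by rewrite /Ebound !addr_ge0 ?invr_ge0 ?modc_ge0. Qed.

(** The bounds [C1] and [C2] are free so that one constant serves a whole neighbourhood in
    [Eth_lipschitz]. *)
Lemma modc_EfacB1 x k (C1 C2 : R) : x != 0 -> modc x <= C1 -> (modc x)^-1 <= C2 ->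
  modc (Efac x k - 1) <= (C1 + C2 + 1) * r ^+ k.
Proof.
move=> x0 h1 h2.
rewrite (_ : Efac x k - 1 = - (x * p ^+ k) - p ^+ k.+1 / x + p ^+ k * p ^+ k.+1); last first.
  by rewrite /Efac; field.
apply: le_trans (modcD _ _) _; rewrite !mulrDl lerD //.
  apply: le_trans (modcB _ _) _; rewrite lerD //.
    by rewrite modcN modcM modcX ler_wpM2r.
  rewrite modcM modcV modcX mulrC ler_pM ?invr_ge0 ?modc_ge0 //.
  by rewrite exprS ler_piMl //; case/andP: r01 => // _ /ltW.
by rewrite modcM !modcX mul1r ler_piMr.
Qed.

Lemma EpartS x N : Epart x N.+1 = Epart x N * Efac x N.
Proof. by rewrite /Epart big_ord_recr. Qed.

Lemma Eth_cvg x : x != 0 -> (Epart x @ \oo --> Eth p x)%classic.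
Proof.
move=> x0; suff : cvgn (Epart x) by [].
have Hf k : modc (Efac x k - 1) <= Ebound x * r ^+ k by apply: modc_EfacB1.
have [B HB] := prod_geometric_bounded r01 (Ebound_ge0 x).
apply: (@geometric_increment_cvg _ _ (B * Ebound x) r r01) => n.
rewrite (_ : Epart x n.+1 - Epart x n = Epart x n * (Efac x n - 1)); last first.
  by rewrite EpartS; ring.
rewrite modcM -mulrA ler_pM ?modc_ge0 //.
by apply: le_trans (HB n); exact: (modc_prod_le n Hf).
Qed.

Lemma cvg_expp0 : ((fun N => p ^+ N) @ \oo --> (0 : CC R))%classic.
Proof.
apply: cvg_modc0; rewrite (_ : _ \o _ = GRing.exp r); last first.
  by apply/funext => n /=; rewrite modcX.
by apply: cvg_expr; rewrite ger0_norm //; case/andP: r01.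
Qed.

Lemma Eth1 : Eth p 1 = 0.
Proof.
(* The shift by one skips the empty product, the only nonzero value of the sequence. *)
apply: cvg_lim => //; rewrite -(cvg_shiftS (Epart 1)) (_ : (fun _ => _) = cst 0); last first.
  by apply/funext => n; rewrite /= /Epart big_ord_recl /Efac expr0 mulr1 subrr !mul0r.
exact: cvg_cst.
Qed.

(** Inversion exchanges the two families of factors with an offset of one index. Of the boundary
    factors those with [p ^+ N] tend to 1, and the other two leave the quotient [- x^-1] of
    [Eth_inv]. *)
Lemma Epart_inv x N : x != 0 ->
  Epart x^-1 N * (1 - x) * (1 - p ^+ N / x) = Epart x N * (1 - x^-1) * (1 - x * p ^+ N).
Proof.
move=> x0; elim: N => [|N IH].
  by rewrite /Epart !big_ord0 expr0 !mulr1 div1r !mul1r mulrC.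
rewrite !EpartS.
transitivity (Epart x^-1 N * (1 - x) * (1 - p ^+ N / x) * (1 - x * p ^+ N.+1) * (1 - p ^+ N.+1 / x)).
  by rewrite /Efac invrK; ring.
by rewrite IH /Efac; ring.
Qed.

Lemma Eth_inv x : x != 0 -> Eth p x^-1 = - Eth p x / x.
Proof.
move=> x0; have [->|x1] := eqVneq x 1; first by rewrite invr1 Eth1 oppr0 mul0r.
have xi0 : x^-1 != 0 by rewrite invr_neq0.
have L1 : ((fun N => Epart x^-1 N * (1 - x) * (1 - p ^+ N / x)) @ \oo
    --> Eth p x^-1 * (1 - x) * (1 - 0 / x))%classic.
  apply: cvgM; first by apply: cvgM; [exact: Eth_cvg|exact: cvg_cst].
  by apply: cvgB; [exact: cvg_cst|apply: cvgM; [exact: cvg_expp0|exact: cvg_cst]].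
have L2 : ((fun N => Epart x^-1 N * (1 - x) * (1 - p ^+ N / x)) @ \oo
    --> Eth p x * (1 - x^-1) * (1 - x * 0))%classic.
  under [X in (X @ _ --> _)%classic]funext => N do rewrite Epart_inv //.
  apply: cvgM; first by apply: cvgM; [exact: Eth_cvg|exact: cvg_cst].
  by apply: cvgB; [exact: cvg_cst|apply: cvgM; [exact: cvg_cst|exact: cvg_expp0]].
have := cvg_unique _ L1 L2; rewrite mul0r mulr0 subr0 !mulr1 => H.
have x1' : 1 - x != 0 by rewrite subr_eq0 eq_sym.
apply: (mulIf x1'); rewrite H //; by field.
Qed.

Lemma modc_lim_ge (u : nat -> CC R) (l : CC R) (b : R) K : (u @ \oo --> l)%classic ->
  (forall n, (K <= n)%N -> b <= modc (u n)) -> b <= modc l.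
Proof.
move=> /cvg_modcP H Hb; rewrite leNgt; apply/negP => lb.
have /H[N HN] : 0 < b - modc l by rewrite subr_gt0.
have := HN (maxn N K) (leq_maxl _ _); have := Hb (maxn N K) (leq_maxr _ _).
have := modcD (u (maxn N K) - l) l; rewrite subrK.
by move=> h1 h2 h3; lra.
Qed.

Lemma modc_lim_le (u : nat -> CC R) (l : CC R) (b : R) : (u @ \oo --> l)%classic ->
  (forall n, modc (u n) <= b) -> modc l <= b.
Proof.
move=> /cvg_modcP H Hb; rewrite leNgt; apply/negP => lb.
have /H[N HN] : 0 < modc l - b by rewrite subr_gt0.
have := HN N (leqnn _); have := Hb N.
have := modcD (l - u N) (u N); rewrite subrK -(modcN (l - _)) opprB.
by move=> h1 h2 h3; lra.
Qed.

(** Beyond some [K] the deviations from 1 sum to less than 1/2, so [modc_prod_ge] keeps the tail at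
    modulus at least 1/2. *)
Lemma Eth_neq0 x : x != 0 -> (forall k, Efac x k != 0) -> Eth p x != 0.
Proof.
move=> x0 Hx; set C := Ebound x.
have C0 : 0 <= C := Ebound_ge0 x.
have Hf k : modc (Efac x k - 1) <= C * r ^+ k by apply: modc_EfacB1.
have [|K HK] := @geometric_small _ (C / (1 - r)) r (1 / 2) r01; first lra.
have := HK K (leqnn _); rewrite ger0_norm; last first.
  by rewrite !mulr_ge0 // invr_ge0 subr_ge0; case/andP: r01 => // _ /ltW.
move=> {}HK.
have EK0 : Epart x K != 0 by apply/prodf_neq0.
rewrite -modc_gt0; apply: (@lt_le_trans _ _ (modc (Epart x K) * (1 / 2))).
  by rewrite mulr_gt0 ?modc_gt0 //; lra.
apply: (modc_lim_ge (K := K) (Eth_cvg x0)) => n Kn.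
rewrite -(subnKC Kn) /Epart big_split_ord /= modcM ler_wpM2l ?modc_ge0 //.
apply: le_trans (modc_prod_ge (fun i => Efac x (K + i)) _).
have : \sum_(i < n - K) modc (Efac x (K + i) - 1) <= C * r ^+ K * (1 - r)^-1.
  apply: (@le_trans _ _ (\sum_(i < n - K) C * r ^+ K * r ^+ i)).
    by apply: ler_sum => i _; rewrite -mulrA -exprD.
  by rewrite -mulr_sumr ler_wpM2l ?mulr_ge0 // sum_geometric_le // r01.
move: HK; rewrite mulrAC => h1 h2; lra.
Qed.

Lemma Eth_eq0 x : x != 0 -> Eth p x = 0 ->
  exists k, modc x * r ^+ k = 1 \/ modc x = r ^+ k.+1.
Proof.
move=> x0 Ex; have /existsNP[k] : ~ (forall k, Efac x k != 0).
  by move=> /(Eth_neq0 x0); rewrite Ex eqxx.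
move/negP; rewrite negbK /Efac mulf_eq0 !subr_eq0 => /orP[] /eqP h; exists k.
  by left; rewrite -modcX -modcM -h modc1.
right; rewrite -modcX; have : modc (p ^+ k.+1 / x) = 1 by rewrite -h modc1.
by rewrite modcM modcV => /(congr1 ( *%R^~ (modc x))); rewrite mulfVK ?modc_eq0 // mul1r.
Qed.

Lemma Eth_lipschitz x : x != 0 -> exists L, forall y, modc (y - x) <= modc x / 2 ->
  modc (Eth p y - Eth p x) <= L * modc (y - x).
Proof.
move=> x0; have mx0 : 0 < modc x by rewrite modc_gt0.
(* On the disc of radius [modc x / 2] both [modc y] and its inverse are at most twice their values
   at [x]. *)
pose C := 2 * modc x + 2 * (modc x)^-1 + 1.
have C0 : 0 <= C by rewrite /C !addr_ge0 ?mulr_ge0 ?invr_ge0 ?modc_ge0.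
have [B HB] := prod_geometric_bounded r01 C0.
have [r0' r1'] := andP r01.
pose D := 1 + 2 * (modc x)^-1 ^+ 2.
have D0 : 0 <= D by rewrite /D addr_ge0 // mulr_ge0 // sqr_ge0.
exists (D * (1 - r)^-1 * B) => y yx.
have my : modc x / 2 <= modc y.
  by have := modcD (x - y) y; rewrite subrK -(modcN (x - y)) opprB; lra.
have my0 : 0 < modc y by apply: lt_le_trans my; rewrite divr_gt0.
have y0 : y != 0 by rewrite -modc_gt0.
have myV : (modc y)^-1 <= 2 * (modc x)^-1.
  by rewrite -[leRHS]invf_div lef_pV2 ?posrE ?divr_gt0.
have my2 : modc y <= 2 * modc x.
  by have := modcD (y - x) x; rewrite subrK; lra.
have Hx k : modc (Efac x k - 1) <= C * r ^+ k.
  have mxV : 0 < (modc x)^-1 by rewrite invr_gt0.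
  by apply: modc_EfacB1 => //; lra.
have Hy k : modc (Efac y k - 1) <= C * r ^+ k by apply: modc_EfacB1.
have Hyx k : modc (Efac y k - Efac x k) <= modc (y - x) * D * r ^+ k.
  rewrite (_ : _ - _ = - ((y - x) * p ^+ k) + (y - x) * p ^+ k.+1 / (x * y)); last first.
    by rewrite /Efac; field; rewrite x0 y0.
  apply: le_trans (modcD _ _) _.
  rewrite modcN !modcM modcV modcM !modcX -!mulrA -mulrDr ler_wpM2l ?modc_ge0 //.
  rewrite /D mulrDl mul1r lerD2l -/r mulrC ler_pM // ?invr_ge0 ?mulr_ge0 ?modc_ge0 //.
    by rewrite invfM expr2 mulrCA ler_wpM2l // invr_ge0 ltW.
  by rewrite exprS; apply: ler_piMl (rk0 k) (ltW r1').
apply: (modc_lim_le (u := fun n => Epart y n - Epart x n)).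
  by apply: cvgB; apply: Eth_cvg.
move=> n; apply: le_trans (modc_prodB_le n Hy Hx Hyx) _.
apply: (@le_trans _ _ (modc (y - x) * D * (1 - r)^-1 * B)).
  rewrite ler_pM //.
  - by apply: sumr_ge0 => k _; rewrite !mulr_ge0 ?modc_ge0.
  - by apply: prodr_ge0 => k _; rewrite addr_ge0 // mulr_ge0.
  by rewrite -mulr_sumr ler_wpM2l ?mulr_ge0 ?modc_ge0 // sum_geometric_le // r01.
by rewrite [leRHS]mulrC !mulrA.
Qed.

Lemma Eth_seq_continuous x (u : nat -> CC R) : x != 0 -> (u @ \oo --> x)%classic ->
  ((fun n => Eth p (u n)) @ \oo --> Eth p x)%classic.
Proof.
move=> x0 /cvg_modcP H; have [L HL] := Eth_lipschitz x0.
apply/cvg_modcP => e e0.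
have mx : 0 < modc x / 2 by rewrite divr_gt0 // modc_gt0.
have L1 : 0 < `|L| + 1 by rewrite ltr_wpDl.
have [N1 H1] := H _ mx; have [N2 H2] := H (e / (`|L| + 1)) (divr_gt0 e0 L1).
exists (maxn N1 N2) => n; rewrite geq_max => /andP[n1 n2].
apply: le_lt_trans (HL _ (ltW (H1 n n1))) _.
apply: (@le_lt_trans _ _ ((`|L| + 1) * modc (u n - x))).
  by rewrite ler_wpM2r ?modc_ge0 // (le_trans (ler_norm _)) // lerDl.
by rewrite mulrC -ltr_pdivlMr // H2.
Qed.

End Theta.

(** * Finite triple product and addition formula *)

(** Multiplicative counterpart of [thetaS]; the division by [x] makes it antisymmetric under the
    inversion formula for [E]. *)
Definition thpair (F : fieldType) (E : F -> F) (x y : F) : F :=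
  E (x * y) * E (x / y) / x.

Section TripleProduct.
Variables (R : realType) (h : CC R).
Let p := h ^+ 2.
Hypothesis p1 : `|p| < 1.
Hypothesis h0 : h != 0.
Let p0 : p != 0. Proof. by rewrite expf_neq0. Qed.
Let r := modc p.
Let rho := modc h.
Let rE : r = rho ^+ 2. Proof. by rewrite /r modcX. Qed.
Let r0 : 0 < r. Proof. by rewrite modc_gt0. Qed.
Let r1 : r < 1. Proof. by rewrite modc_lt1. Qed.
Let r01 : 0 <= r < 1. Proof. by rewrite ltW. Qed.
Let rho0 : 0 < rho. Proof. by rewrite modc_gt0. Qed.
Implicit Types x y : CC R.

Definition qfact (n : nat) : CC R := \prod_(i < n) (1 - p ^+ i.+1).

Lemma qfactS n : qfact n.+1 = qfact n * (1 - p ^+ n.+1).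
Proof. by rewrite /qfact big_ord_recr. Qed.

Let pX1 n : 1 - p ^+ n.+1 != 0.
Proof.
rewrite subr_eq0; apply/eqP => /(congr1 (@modc R)); rewrite modc1 modcX => /esym/eqP.
by rewrite lt_eqF // exprn_ilt1 // modc_ge0.
Qed.

Lemma qfact_neq0 n : qfact n != 0.
Proof. by apply/prodf_neq0. Qed.

Definition qbin (M m : nat) : CC R :=
  if (m <= M)%N then qfact M / (qfact m * qfact (M - m)) else 0.

Lemma qbin0 M : qbin M 0 = 1.
Proof. by rewrite /qbin subn0 {2}/qfact big_ord0 mul1r divff ?qfact_neq0. Qed.

Lemma qbin_pascal M m : (m <= M)%N ->
  qbin M.+1 m.+1 = qbin M m.+1 + p ^+ (M - m) * qbin M m.
Proof.
rewrite leq_eqVlt => /predU1P[->|mM].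
  rewrite /qbin leqnn ltnn !subnn add0r mul1r leqnn /qfact big_ord0 !mulr1.
  by rewrite !divff // -/(qfact _) qfact_neq0.
rewrite /qbin ltnS (ltnW mM) mM subSS -(subnSK mM) !qfactS.
have e : p ^+ M.+1 = p ^+ (M - m.+1).+1 * p ^+ m.+1.
  by rewrite -exprD; congr (_ ^+ _); lia.
rewrite e; field.
by rewrite !qfact_neq0 !pX1.
Qed.

Lemma qbinomial (M : nat) y :
  \prod_(i < M) (1 + y * p ^+ i) = \sum_(m < M.+1) p ^+ 'C(m, 2) * qbin M m * y ^+ m.
Proof.
elim: M => [|M IH]; first by rewrite big_ord0 big_ord1 qbin0 bin0n !mulr1.
rewrite big_ord_recr /= IH mulrDr mulr1 [RHS]big_ord_recl /= qbin0.
under [in RHS]eq_bigr => m _.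
  rewrite /bump /= add1n qbin_pascal -1?ltnS // mulrDr mulrDl.
  over.
rewrite big_split /= addrA; congr (_ + _).
  rewrite [LHS]big_ord_recl /= qbin0; congr (_ + _).
  have out : qbin M M.+1 = 0 by rewrite /qbin ltnn.
  rewrite [RHS]big_ord_recr /= out mulr0 mul0r addr0.
  by apply: eq_bigr => m _; rewrite /bump /= add1n.
rewrite mulr_suml; apply: eq_bigr => m _.
have mM : (m <= M)%N by rewrite -ltnS.
rewrite binS bin1 exprD.
have -> : p ^+ M = p ^+ m * p ^+ (M - m) by rewrite -exprD subnKC.
by rewrite exprS; ring.
Qed.

(** The coefficient is [p^(n(n-1)/2)]; with the square root [h] of [p] the exponent is a polynomial
    over the integers. *)
Definition theta_term x (n : int) : CC R := (- x) ^ n * h ^ (n * n - n).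

(** Finite Jacobi triple product: the q-binomial theorem for [2N] factors at [y = - x p^(-N)]. The
    upper half of the factors gives [1 - x p^i]; the lower half, reversed, gives [1 - p^(i+1)/x] up
    to monomials. *)
Lemma Epart_theta x N : x != 0 -> Epart p x N =
  \sum_(m < (2 * N).+1) qbin (2 * N) m * theta_term x (m%:Z - N%:Z).
Proof.
move=> x0; have nx0 : - x != 0 by rewrite oppr_eq0.
have hp (n : nat) : p ^+ n = h ^ (2 * n%:Z) by rewrite /p -exprM -exprnP.
have key : \prod_(i < 2 * N) (1 + (- x) * h ^ (- 2 * N%:Z) * p ^+ i)
   = Epart p x N * ((- x) ^ N%:Z * h ^ (- (N%:Z * N%:Z + N%:Z))).
  rewrite mul2n -addnn big_split_ord /=.
  have -> : \prod_(i < N) (1 + - x * h ^ (-2 * N%:Z) * p ^+ (N + i))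
     = \prod_(i < N) (1 - x * p ^+ i).
    apply: eq_bigr => i _; rewrite !hp -mulrA -expfzDr //.
    rewrite (_ : -2 * N%:Z + 2 * (N + i)%N%:Z = 2 * i%:Z); last by rewrite PoszD; ring.
    by rewrite mulNr.
  rewrite /Epart /Efac big_split /= mulrC -[RHS]mulrA; congr (_ * _).
  rewrite (reindex_inj rev_ord_inj) /=.
  have -> : (- x) ^ N%:Z * h ^ (- (N%:Z * N%:Z + N%:Z))
      = \prod_(i < N) (- x * h ^ (- 2 * i.+1%:Z)).
    elim: N => [|N IH]; first by rewrite big_ord0 mulr0 addr0 oppr0 !expr0z mulr1.
    rewrite big_ord_recr /= -IH mulrACA -expfzDr // -exprSzr.
    by congr (_ ^ _ * h ^ _); ring.
  rewrite -big_split; apply: eq_bigr => i _ /=.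
  have -> : - x * h ^ (-2 * N%:Z) * p ^+ (N - i.+1) = - x * h ^ (- 2 * i.+1%:Z).
    by rewrite hp -mulrA -expfzDr //; congr (_ * h ^ _); have := ltn_ord i; lia.
  rewrite [in RHS]hp (_ : -2 * i.+1%:Z = - (2 * i.+1%:Z)); last by ring.
  rewrite -invr_expz; have z0 : h ^ (2 * i.+1%:Z) != 0 by rewrite expfz_neq0.
  by field; rewrite x0 z0.
rewrite qbinomial in key.
have w0 : (- x) ^ N%:Z * h ^ (- (N%:Z * N%:Z + N%:Z)) != 0.
  by rewrite mulf_neq0 // expfz_neq0.
apply: (mulIf w0); rewrite -key mulr_suml; apply: eq_bigr => m _.
rewrite mulrAC mulrC -[RHS]mulrA; congr (_ * _); rewrite /theta_term.
have bin2 : 2 * 'C(m, 2)%:Z = m%:Z * m%:Z - m%:Z.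
  case: (m : nat) => [//|k]; have := mul_bin_diag k.+1 1; rewrite /= bin1 => e.
  by rewrite -[2]/(2%N%:Z) -PoszM -e PoszM; ring.
rewrite hp bin2 exprMn -[(- x) ^+ m]/((- x) ^ m%:Z) -[_ ^+ m]/(_ ^ m%:Z) exprz_exp.
have e1 : (- x) ^ m%:Z = (- x) ^ (m%:Z - N%:Z) * (- x) ^ N%:Z.
  by rewrite -expfzDr // subrK.
have e2 : h ^ (m%:Z * m%:Z - m%:Z) * h ^ (-2 * N%:Z * m%:Z) =
    h ^ ((m%:Z - N%:Z) * (m%:Z - N%:Z) - (m%:Z - N%:Z)) * h ^ (- (N%:Z * N%:Z + N%:Z)).
  by rewrite -!expfzDr //; congr (h ^ _); ring.
by rewrite mulrCA e2 e1 mulrACA.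
Qed.

Lemma modcXz x (n : int) : modc (x ^ n) = modc x ^ n.
Proof. by case: n => n; rewrite ?NegzE -?exprnP -?exprnN ?modcV modcX. Qed.

(** Consecutive values have quotient [Y * r ^+ k], eventually below 1. *)
Lemma gaussian_bounded (Y : R) : 0 <= Y ->
  exists2 C, 0 <= C & forall k : nat, Y ^+ k * rho ^+ (k * k.-1) <= C.
Proof.
move=> Y0; pose v k := Y ^+ k * rho ^+ (k * k.-1).
have v0 k : 0 <= v k by rewrite mulr_ge0 ?exprn_ge0 ?modc_ge0.
have vS k : v k.+1 = v k * (Y * r ^+ k).
  rewrite /v /= exprS rE -exprM (_ : k.+1 * k = k * k.-1 + 2 * k)%N;
    last by case: k; clear; lia.
  by rewrite exprD; ring.
have [K HK] := geometric_small Y r01 (ltr01 : 0 < 1 :> R).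
exists (\sum_(k < K.+1) v k) => [|k]; first by apply: sumr_ge0.
have small i : (i < K.+1)%N -> v i <= \sum_(j < K.+1) v j.
  by move=> kK; rewrite (bigD1 (Ordinal kK)) //= lerDl sumr_ge0.
have [kK|Kk] := ltnP k K.+1; first exact: small.
have {}Kk := ltnW Kk; rewrite -(subnKC Kk); elim: (k - K)%N => [|i IH].
  by rewrite addn0; apply: small.
apply: le_trans IH; rewrite addnS -/(v _) -/(v _) vS ler_piMr //.
have := HK (K + i)%N (leq_addr _ _); rewrite ger0_norm ?mulr_ge0 ?exprn_ge0 ?modc_ge0 //.
exact: ltW.
Qed.

Lemma theta_term_bound x : x != 0 -> exists2 C, 0 <= C &
  forall n : int, modc (theta_term x n) <= C * r ^+ `|n|%N.
Proof.
move=> x0; have mx : 0 < modc x by rewrite modc_gt0.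
have [C1 C10 H1] := gaussian_bounded (ltW (divr_gt0 mx r0)).
have mxV : 0 <= (modc x)^-1 by rewrite invr_ge0 ltW.
have [C2 C20 H2] := gaussian_bounded mxV.
exists (C1 + C2) => [|n]; first by rewrite addr_ge0.
have rk k : 0 <= r ^+ k by rewrite exprn_ge0 // ltW.
rewrite /theta_term modcM !modcXz modcN -/rho; case: n => k.
  rewrite [absz _]/= -exprnP.
  have -> : rho ^ (k%:Z * k%:Z - k%:Z) = rho ^+ (k * k.-1).
    by rewrite exprnP; congr (_ ^ _); case: k => // k; rewrite PoszM; clear; lia.
  apply: (@le_trans _ _ (C1 * r ^+ k)); last by rewrite ler_wpM2r // lerDl.
  apply: le_trans (_ : (modc x / r) ^+ k * rho ^+ (k * k.-1) * r ^+ k <= _).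
    rewrite mulrAC -exprMn divfK ?lt0r_neq0 //.
  by rewrite ler_wpM2r.
rewrite NegzE abszN [absz _]/=; move: k.+1 => {}k.
rewrite (_ : - k%:Z * - k%:Z - - k%:Z = (k * k.-1 + 2 * k)%N); last first.
  by case: k => // k; rewrite PoszD !PoszM /=; clear; lia.
rewrite -exprnN -exprnP exprD (exprM _ 2 k) -rE -exprVn mulrA.
rewrite ler_wpM2r //; apply: le_trans (H2 k) _.
by rewrite lerDr.
Qed.

(** The inverses are bounded because the tail products stay above 1/2 and the finitely many initial
    values are nonzero. *)
Lemma qfact_bounds : exists B, [/\ 0 < B, forall n, modc (qfact n) <= B,
  forall n, (modc (qfact n))^-1 <= B
  & forall a b, (a <= b)%N -> modc (qfact b - qfact a) <= B * r ^+ a].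
Proof.
have Hf k : modc ((1 - p ^+ k.+1) - 1) <= 1 * r ^+ k.
  rewrite addrAC subrr add0r modcN modcX mul1r exprS ler_piMl ?exprn_ge0 ?(ltW r0) ?(ltW r1) //.
have [B HB] := prod_geometric_bounded r01 (ler01 : 0 <= 1 :> R).
have B1 : 1 <= B by have := HB 0; rewrite big_ord0.
have up n : modc (qfact n) <= B by apply: le_trans (HB n); exact: (modc_prod_le n Hf).
have s1 : 0 < (1 - r)^-1 by rewrite invr_gt0 subr_gt0.
have diff a b : (a <= b)%N -> modc (qfact b - qfact a) <= B * (B * (1 - r)^-1) * r ^+ a.
  move=> ab; rewrite -(subnKC ab) /qfact big_split_ord /= -/(qfact a).
  rewrite -{2}[qfact a]mulr1 -mulrBr modcM -[leRHS]mulrA ler_pM ?modc_ge0 //.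
  have one : 1 = \prod_(i < b - a) 1 :> CC R by rewrite big1.
  rewrite [X in _ - X]one.
  have H1 k : modc ((1 - p ^+ (a + k).+1) - 1) <= 1 * r ^+ k.
   
      by apply: le_trans (Hf _) _; rewrite !mul1r ler_wiXn2l // ?(ltW r0) ?(ltW r1) // leq_addl.
  have H2 k : modc (1 - 1 : CC R) <= 1 * r ^+ k.
    by rewrite subrr modc0 mul1r exprn_ge0 ?(ltW r0).
  have H3 k : modc ((1 - p ^+ (a + k).+1) - 1) <= r ^+ a * r ^+ k.
    by apply: le_trans (Hf _) _; rewrite mul1r exprD.
  apply: le_trans (modc_prodB_le (b - a) H1 H2 H3) _.
  rewrite -mulr_sumr [leRHS]mulrC -mulrA ler_wpM2l ?exprn_ge0 ?(ltW r0) //.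
  rewrite [leRHS]mulrC ler_pM //.
  - by apply: sumr_ge0 => i _; rewrite exprn_ge0 ?(ltW r0).
  - by apply: prodr_ge0 => i _; rewrite addr_ge0 // mul1r exprn_ge0 ?(ltW r0).
  by rewrite sum_geometric_le.
have [l [l0 Hl]] : exists l, 0 < l /\ forall n, l <= modc (qfact n).
  have [|K HK] := @geometric_small _ ((1 - r)^-1) r (1 / 2) r01; first lra.
  have tail n : 1 / 2 <= modc (\prod_(i < n) (1 - p ^+ (K + i).+1)).
    apply: le_trans (modc_prod_ge (fun i => 1 - p ^+ (K + i).+1) _).
    have : \sum_(i < n) modc (1 - p ^+ (K + i).+1 - 1) <= r ^+ K * (1 - r)^-1.
      apply: (@le_trans _ _ (\sum_(i < n) r ^+ K * r ^+ i)).
        by apply: ler_sum => i _; rewrite -exprD; apply: le_trans (Hf _) _; rewrite mul1r.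
      by rewrite -mulr_sumr ler_wpM2l ?exprn_ge0 ?(ltW r0) // sum_geometric_le.
    have := HK K (leqnn _); rewrite ger0_norm ?mulr_ge0 ?exprn_ge0 ?(ltW s1) ?(ltW r0) //.
    by rewrite mulrC => h1 h2; lra.
  pose l := \big[Num.min/1]_(n < K.+1) modc (qfact n).
  have lpos : 0 < l.
    rewrite /l; elim/big_ind: _ => // [x y x0 y0|n _]; first by rewrite lt_min x0.
    by rewrite modc_gt0 qfact_neq0.
  exists (l / 2); split; first by rewrite divr_gt0.
  move=> n; have lK k : (k <= K)%N -> l <= modc (qfact k).
    by move=> kK; rewrite /l (bigD1 (Ordinal (kK : (k < K.+1)%N))) //= ge_min lexx.
  have [nK|Kn] := leqP n K; first by apply: le_trans (lK n nK); lra.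
  rewrite -(subnKC (ltnW Kn)) /qfact big_split_ord /= -/(qfact K) modcM.
  by rewrite ler_pM ?invr_ge0 ?(ltW lpos) ?lK // -[2^-1]mul1r tail.
exists (B + B * (B * (1 - r)^-1) + l^-1).
have B0 : 0 < B by lra.
have lV : 0 < l^-1 by rewrite invr_gt0.
have BB : 0 < B * (B * (1 - r)^-1) by rewrite !mulr_gt0.
split=> [|n|n|a b ab]; first by rewrite !addr_gt0.
- by apply: le_trans (up n) _; lra.
- apply: (@le_trans _ _ l^-1); last lra.
  by rewrite lef_pV2 ?posrE // modc_gt0 qfact_neq0.
apply: le_trans (diff a b ab) _; rewrite ler_wpM2r ?exprn_ge0 ?(ltW r0) //; lra.
Qed.

(** The estimate is weak for [m] near 0 or [2N], exactly where [theta_term] is small: with the bound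
    [r ^+ |m - N|] there, every term of the finite triple product is off by at most a constant times
    [r ^+ N]. *)
Lemma qbin_near : exists2 D, 0 <= D & forall N m, (m <= 2 * N)%N ->
  modc (qbin (2 * N) N) <= D /\
  modc (qbin (2 * N) m - qbin (2 * N) N) <= D * r ^+ (N - `|m%:Z - N%:Z|).
Proof.
have [B [B0 HB HV Hd]] := qfact_bounds.
have B0' := ltW B0.
have mV n : modc (qfact n)^-1 <= B by rewrite modcV.
exists (B ^+ 3 + 2 * B ^+ 7) => [|N m mN]; first by rewrite addr_ge0 ?mulr_ge0 ?exprn_ge0.
have NN : (N <= 2 * N)%N by rewrite leq_pmull.
have subN : (2 * N - N = N)%N by rewrite mul2n -addnn addnK.
have B37 : B ^+ 3 <= B ^+ 3 + 2 * B ^+ 7 by rewrite lerDl mulr_ge0 ?exprn_ge0.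
have B73 : 2 * B ^+ 7 <= B ^+ 3 + 2 * B ^+ 7 by rewrite lerDr exprn_ge0.
split.
  rewrite /qbin NN subN; apply: le_trans B37.
  by rewrite invfM !modcM !exprS expr0 mulr1 ler_pM ?mulr_ge0 ?modc_ge0 // ler_pM ?modc_ge0.
set k := (N - _)%N.
have kN : (k <= N)%N by rewrite leq_subr.
have km : (k <= m)%N by rewrite /k; move: mN; clear; lia.
have km' : (k <= 2 * N - m)%N by rewrite /k; move: mN; clear; lia.
have near a : (k <= a)%N -> modc (qfact N - qfact a) <= B * r ^+ k.
  have rka b : (k <= b)%N -> B * r ^+ b <= B * r ^+ k.
    by move=> kb; rewrite ler_wpM2l // ler_wiXn2l ?(ltW r0) ?(ltW r1).
  move=> ka; have [aN|Na] := leqP a N.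
    by apply: le_trans (Hd _ _ aN) _; apply: rka.
  by rewrite -modcN opprB; apply: le_trans (Hd _ _ (ltnW Na)) _; apply: rka.
rewrite /qbin mN NN subN.
have -> : qfact (2 * N) / (qfact m * qfact (2 * N - m)) - qfact (2 * N) / (qfact N * qfact N)
  = qfact (2 * N) * (qfact m)^-1 * (qfact (2 * N - m))^-1 * (qfact N)^-1 * (qfact N)^-1
    * (qfact N * (qfact N - qfact m) + qfact m * (qfact N - qfact (2 * N - m))).
  by field; rewrite !qfact_neq0.
apply: (@le_trans _ _ (B ^+ 5 * (2 * B ^+ 2 * r ^+ k))); last first.
  rewrite (_ : B ^+ 5 * _ = 2 * B ^+ 7 * r ^+ k); last by ring.
  by rewrite ler_wpM2r ?exprn_ge0 ?(ltW r0).
rewrite modcM ler_pM ?modc_ge0 //.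
  rewrite !modcM !exprSr expr0 mul1r.
  by do 4 (rewrite ler_pM ?mulr_ge0 ?modc_ge0 //).
rewrite (_ : 2 * _ * _ = B * (B * r ^+ k) + B * (B * r ^+ k)); last by ring.
by apply: le_trans (modcD _ _) _; rewrite !modcM lerD // ler_pM ?modc_ge0 ?near.
Qed.

Lemma cvg0_quadratic_geometric (u : nat -> CC R) (A : R) :
  (forall N, modc (u N) <= A * (N.+1%:R ^+ 2 * r ^+ N)) -> (u @ \oo --> (0 : CC R))%classic.
Proof.
(* A fourth root of [r]: two factors [w ^+ N] absorb the square of [N.+1], and [(w ^+ 2) ^+ N] is
   left to decay. *)
move=> Hu; pose w := Num.sqrt (Num.sqrt r).
have r0' := ltW r0.
have wE : w ^+ 4 = r by rewrite (exprM w 2 2) !sqr_sqrtr ?sqrtr_ge0.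
have w0 : 0 <= w by apply: sqrtr_ge0.
have w1 : w < 1.
  by rewrite -(@expr_lt1 _ 4) // wE.
have w01 : 0 <= w < 1 by rewrite w0.
have lin N : N.+1%:R * w ^+ N <= (1 - w)^-1.
  apply: le_trans (sum_geometric_le N.+1 w01).
  rewrite mulr_natl -[X in _ *+ X](card_ord N.+1) -sumr_const.
  by apply: ler_sum => i _; rewrite ler_wiXn2l // ?(ltW w1) // -ltnS.
have quad N : N.+1%:R ^+ 2 * r ^+ N <= (1 - w)^-1 ^+ 2 * (w ^+ 2) ^+ N.
  have e : r ^+ N = (w ^+ N) ^+ 2 * (w ^+ 2) ^+ N.
    by rewrite -wE -!exprM -exprD; congr (_ ^+ _); ring.
  rewrite e mulrA -exprMn.
  by rewrite ler_wpM2r ?exprn_ge0 // lerXn2r ?nnegrE ?mulr_ge0 ?ler0n ?exprn_ge0 ?invr_ge0 ?subr_ge0 ?(ltW w1).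
have w201 : 0 <= w ^+ 2 < 1 by rewrite exprn_ge0 // exprn_ilt1.
apply/cvg_modcP => e e0.
have [K HK] := @geometric_small _ (`|A| * (1 - w)^-1 ^+ 2) _ _ w201 e0.
exists K => n Kn; rewrite subr0; apply: le_lt_trans (Hu n) _.
apply: le_lt_trans (HK n Kn); apply: le_trans (ler_norm _).
apply: (@le_trans _ _ (`|A| * (n.+1%:R ^+ 2 * r ^+ n))).
  by rewrite ler_wpM2r ?ler_norm // mulr_ge0 ?exprn_ge0.
by rewrite -[leRHS]mulrA ler_wpM2l.
Qed.

(** * Truncated theta series and the splitting of their products by parity *)

Definition int_range (N : nat) : seq int := [seq i%:Z - N%:Z | i <- iota 0 (2 * N).+1].

Lemma mem_int_range N (x : int) : (x \in int_range N) = (`|x| <= N)%N.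
Proof.
apply/mapP/idP => [|xN]; first by case=> i; rewrite mem_iota => /andP[_ iN] ->; lia.
by exists (absz (x + N%:Z)); rewrite ?mem_iota; lia.
Qed.

Lemma uniq_int_range N : uniq (int_range N).
Proof.
rewrite map_inj_uniq ?iota_uniq // => i j; lia.
Qed.

Lemma big_int_range (f : int -> CC R) N :
  \sum_(n <- int_range N) f n = \sum_(m < (2 * N).+1) f (m%:Z - N%:Z).
Proof. by rewrite big_map -{1}[(2 * N).+1]subn0 -/(index_iota _ _) big_mkord. Qed.

Definition theta_sum x N := \sum_(n <- int_range N) theta_term x n.

(** The triple product with the central coefficient kept as a factor, so that its own limit need not
    be identified. *)
Lemma central_theta_cvg x : x != 0 ->
  ((fun N => qbin (2 * N) N * theta_sum x N) @ \oo --> Eth p x)%classic.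
Proof.
move=> x0; have [C C0 HC] := theta_term_bound x0; have [D D0 HD] := qbin_near.
have E := Eth_cvg p1 x0.
have Z : ((fun N => Epart p x N - qbin (2 * N) N * theta_sum x N) @ \oo --> (0 : CC R))%classic.
  apply: (@cvg0_quadratic_geometric _ (2 * (D * C))) => N.
  rewrite Epart_theta // /theta_sum big_int_range mulr_sumr -sumrB.
  have : modc (\sum_(m < (2 * N).+1) (qbin (2 * N) m * theta_term x (m%:Z - N%:Z)
      - qbin (2 * N) N * theta_term x (m%:Z - N%:Z))) <=
      \sum_(m < (2 * N).+1) D * C * r ^+ N.
    elim/big_ind2: _ => [|a1 b1 a2 b2 h1 h2|m _]; first by rewrite modc0.
      by apply: le_trans (modcD _ _) _; rewrite lerD.
    have mN : (m <= 2 * N)%N by rewrite -ltnS.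
    have [_ H2] := HD N m mN; rewrite -mulrBl modcM.
    apply: (@le_trans _ _ (D * r ^+ (N - `|m%:Z - N%:Z|) * (C * r ^+ `|m%:Z - N%:Z|))).
      by rewrite ler_pM ?modc_ge0.
    by rewrite mulrACA -exprD subnK //; move: mN; clear; lia.
  move=> /le_trans; apply; rewrite sumr_const card_ord -[leLHS]mulr_natl.
  rewrite (_ : 2 * (D * C) * _ = (2 * N.+1%:R ^+ 2) * (D * C * r ^+ N)); last by ring.
  rewrite ler_wpM2r ?mulr_ge0 ?exprn_ge0 ?(ltW r0) //.
  by rewrite -natrX -natrM ler_nat; lia.
rewrite -[Eth p x]subr0 (_ : (fun N => _) = (fun N =>
    Epart p x N - (Epart p x N - qbin (2 * N) N * theta_sum x N))); last first.
  by apply/funext => N; rewrite opprB addrC subrK.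
exact: cvgB E Z.
Qed.

(** Divided by [x], this is the truncated [A] of the rank-two form [A(x) B(y) - B(x) A(y)];
    [theta_odd] is [B]. *)
Definition theta_even x N : CC R :=
  \sum_(i <- int_range N) x ^ (2 * i) * h ^ (2 * (i * i - i)).

Definition theta_odd x N : CC R :=
  \sum_(i <- int_range N) x ^ (2 * i) * h ^ (2 * (i * i)).

(** The variables separate because [(i+j)^2 + (i-j)^2] has no mixed term. The linear part of the
    exponent falls on [i] here, but on [j] in [theta_term_odd], which exchanges the two series. *)
Lemma theta_term_even x y (i j : int) : x != 0 -> y != 0 ->
  theta_term (x * y) (i + j) * theta_term (x / y) (i - j) =
  (x ^ (2 * i) * h ^ (2 * (i * i - i))) * (y ^ (2 * j) * h ^ (2 * (j * j))).
Proof.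
move=> x0 y0; have nx0 : - x != 0 by rewrite oppr_eq0.
have sq : x ^ (2 * i) = (- x) ^ (i + j) * (- x) ^ (i - j).
  rewrite -expfzDr // (_ : i + j + (i - j) = 2 * i); last by ring.
  by rewrite -!exprz_exp -!exprnP sqrrN.
have yq : y ^ (2 * j) = y ^ (i + j) * y ^ (- (i - j)).
  by rewrite -expfzDr //; congr (_ ^ _); ring.
have hq : h ^ (2 * (i * i - i)) * h ^ (2 * (j * j)) =
    h ^ ((i + j) * (i + j) - (i + j)) * h ^ ((i - j) * (i - j) - (i - j)).
  by rewrite -!expfzDr //; congr (_ ^ _); ring.
rewrite [RHS]mulrACA hq sq yq /theta_term -!mulNr !expfzMl exprz_inv; ring.
Qed.

Lemma theta_term_odd x y (i j : int) : x != 0 -> y != 0 ->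
  theta_term (x * y) (i + j) * theta_term (x / y) (i - j + 1) =
  - (x / y) * ((x ^ (2 * i) * h ^ (2 * (i * i)))
    * (y ^ (2 * j) * h ^ (2 * (j * j - j)))).
Proof.
move=> x0 y0; have nx0 : - x != 0 by rewrite oppr_eq0.
have sq : - x * x ^ (2 * i) = (- x) ^ (i + j) * (- x) ^ (i - j + 1).
  rewrite -expfzDr // (_ : i + j + (i - j + 1) = 2 * i + 1); last by ring.
  by rewrite expfzDr // expr1z mulrC -!exprz_exp -!exprnP sqrrN.
have yq : y^-1 * y ^ (2 * j) = y ^ (i + j) * y ^ (- (i - j + 1)).
  by rewrite -[y^-1]/(y ^ (-1)) -!expfzDr //; congr (_ ^ _); ring.
have hq : h ^ (2 * (i * i)) * h ^ (2 * (j * j - j)) =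
    h ^ ((i + j) * (i + j) - (i + j)) * h ^ ((i - j + 1) * (i - j + 1) - (i - j + 1)).
  by rewrite -!expfzDr //; congr (_ ^ _); ring.
transitivity ((- x * x ^ (2 * i)) * (y^-1 * y ^ (2 * j))
  * (h ^ (2 * (i * i)) * h ^ (2 * (j * j - j)))); last by ring.
by rewrite sq yq hq /theta_term -!mulNr !expfzMl exprz_inv; ring.
Qed.

Let shift0 (z : int * int) := (z.1 + z.2, z.1 - z.2).
Let shift1 (z : int * int) := (z.1 + z.2, z.1 - z.2 + 1).

(* The reindexing (m, n) = (i + j, i - j) or (i + j, i - j + 1) maps two squares
   |i|, |j| <= N onto a set containing the square |m|, |n| <= N; all further terms
   have max(|m|, |n|) > N. *)
Lemma theta_prod_cvg0 x y : x != 0 -> y != 0 ->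
  ((fun N => theta_sum (x * y) N * theta_sum (x / y) N
    - (theta_even x N * theta_odd y N - x / y * (theta_odd x N * theta_even y N)))
   @ \oo --> (0 : CC R))%classic.
Proof.
move=> x0 y0.
have [C1 C10 H1] := theta_term_bound (mulf_neq0 x0 y0).
have xy0 : x / y != 0 by rewrite mulf_neq0 // invr_neq0.
have [C2 C20 H2] := theta_term_bound xy0.
pose tau (z : int * int) := theta_term (x * y) z.1 * theta_term (x / y) z.2.
apply: (@cvg0_quadratic_geometric _ (8 * (C1 * C2))) => N.
pose s := [seq (i, j) | i <- int_range N, j <- int_range N].
have us : uniq s.
  by apply: allpairs_uniq; rewrite ?uniq_int_range // => -[a b] [c d] _ _ [-> ->].
have sS z : (z \in s) = (`|z.1| <= N)%N && (`|z.2| <= N)%N.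
  rewrite -!mem_int_range; apply/allpairsP/andP => [[[a b] [/= ha hb ->]]|[ha hb]] //.
  by exists z; split=> //; case: z {ha hb}.
pose s2 := map shift0 s ++ map shift1 s.
have u2 : uniq s2.
  rewrite cat_uniq; apply/and3P; split.
  - rewrite map_inj_uniq ?us // => -[a b] [c d] /= [e1 e2].
    by congr (_, _); move: e1 e2; clear; lia.
  - apply/hasPn => z /mapP[[a b] _ ->]; apply/mapP => -[[c d] _ [e1 e2]].
    by move: e1 e2; clear; lia.
  - rewrite map_inj_uniq ?us // => -[a b] [c d] /= [e1 e2].
    by congr (_, _); move: e1 e2; clear; lia.
have sub : {subset s <= s2}.
  move=> [m n]; rewrite sS /= => /andP[hm hn]; rewrite mem_cat.
  (* [k] plays the role of [i]; both shifts have first component [i + j], so [j = m - k] in either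
     case. *)
  have [k mk] : exists k : int, m + n = 2 * k \/ m + n = 2 * k + 1.
    by exists ((m + n) %/ 2)%Z; clear; lia.
  have sk : (k, m - k) \in s by rewrite sS /=; move: hm hn mk; clear; lia.
  apply/orP; case: mk => mk; [left|right]; apply/mapP; exists (k, m - k) => //.
    by rewrite /shift0 /=; congr (_, _); move: mk; clear; lia.
  by rewrite /shift1 /=; congr (_, _); move: mk; clear; lia.
have -> : theta_sum (x * y) N * theta_sum (x / y) N = \sum_(z <- s) tau z.
  by rewrite /theta_sum big_distrlr /= big_allpairs.
have -> : theta_even x N * theta_odd y N - x / y * (theta_odd x N * theta_even y N)
    = \sum_(z <- s2) tau z.
  rewrite /s2 big_cat !big_map; congr (_ + _).
    rewrite big_distrlr /= big_allpairs; apply: eq_bigr => i _; apply: eq_bigr => j _.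
    by rewrite /tau /= theta_term_even.
  rewrite big_distrlr /= -mulNr mulr_sumr big_allpairs; apply: eq_bigr => i _.
  by rewrite mulr_sumr; apply: eq_bigr => j _; rewrite /tau /= theta_term_odd.
have perm : perm_eq s2 (s ++ [seq z <- s2 | z \notin s]).
  apply: uniq_perm => //.
    rewrite cat_uniq us filter_uniq // andbT; apply/hasPn => z.
    by rewrite mem_filter => /andP[].
  move=> z; rewrite [in RHS]mem_cat mem_filter; have := sub z.
  by case: (z \in s) => //= ->.
set s3 := [seq z <- s2 | z \notin s] in perm.
have -> : \sum_(z <- s2) tau z = \sum_(z <- s) tau z + \sum_(z <- s3) tau z.
  by rewrite (perm_big _ perm) big_cat.
rewrite opprD addrA subrr add0r modcN.
have sz : (size s3 <= 2 * (2 * N).+1 ^ 2)%N.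
  rewrite size_filter; apply: leq_trans (count_size _ _) _.
  by rewrite /s2 size_cat !size_map size_allpairs !size_map size_iota; clear; lia.
apply: (@le_trans _ _ (\sum_(z <- s3) C1 * C2 * r ^+ N)).
  rewrite !big_seq.
  elim/big_ind2: _ => [|a1 b1 a2 b2 h1 h2|z]; first by rewrite modc0.
    by apply: le_trans (modcD _ _) _; rewrite lerD.
  rewrite mem_filter sS => /andP[zs _]; rewrite /tau modcM.
  apply: (@le_trans _ _ ((C1 * r ^+ `|z.1|%N) * (C2 * r ^+ `|z.2|%N))).
    by rewrite ler_pM ?modc_ge0.
  rewrite mulrACA -exprD ler_wpM2l ?mulr_ge0 // ler_wiXn2l ?(ltW r0) ?(ltW r1) //.
  by move: zs; clear; lia.
rewrite big_const_seq count_predT iter_addr addr0 -[leLHS]mulr_natl.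
rewrite (_ : 8 * (C1 * C2) * _ = (8 * N.+1%:R ^+ 2) * (C1 * C2 * r ^+ N)); last by ring.
rewrite ler_wpM2r ?mulr_ge0 ?exprn_ge0 ?(ltW r0) //.
by rewrite -natrX -natrM ler_nat; apply: leq_trans sz _; clear; lia.
Qed.

Lemma theta_pair_cvg x y : x != 0 -> y != 0 ->
  ((fun N => qbin (2 * N) N ^+ 2 *
     (theta_even x N / x * theta_odd y N - theta_odd x N * (theta_even y N / y)))
   @ \oo --> thpair (Eth p) x y)%classic.
Proof.
move=> x0 y0; have xy0 : x / y != 0 by rewrite mulf_neq0 // invr_neq0.
have [D D0 HD] := qbin_near.
have L1 := cvgM (cvgM (central_theta_cvg (mulf_neq0 x0 y0)) (central_theta_cvg xy0))
  (cvg_cst x^-1).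
have Z := theta_prod_cvg0 x0 y0.
(* The bound [D] on the central coefficient is enough to preserve the limit 0. *)
have Z2 : ((fun N => qbin (2 * N) N ^+ 2 / x * (theta_sum (x * y) N * theta_sum (x / y) N
    - (theta_even x N * theta_odd y N - x / y * (theta_odd x N * theta_even y N))))
   @ \oo --> (0 : CC R))%classic.
  move/cvg_modcP: Z => H; apply/cvg_modcP => e e0.
  have Dx : 0 < D ^+ 2 * (modc x)^-1 + 1.
    by rewrite ltr_wpDl // mulr_ge0 ?exprn_ge0 ?invr_ge0 ?modc_ge0.
  have [N HN] := H _ (divr_gt0 e0 Dx); exists N => n Nn; have := HN n Nn.
  rewrite !subr0 (modcM (_ / x)) (modcM (_ ^+ 2)) modcV modcX ltr_pdivlMr // mulrC.
  apply: le_lt_trans; rewrite ler_wpM2r ?modc_ge0 //.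
  have [Dn _] := HD n 0 isT.
  apply: (@le_trans _ _ (D ^+ 2 * (modc x)^-1)); last by rewrite lerDl.
  by rewrite ler_wpM2r ?invr_ge0 ?modc_ge0 // lerXn2r ?nnegrE ?modc_ge0.
rewrite -[thpair (Eth p) x y]subr0 (_ : (fun N => _) = (fun N =>
   qbin (2 * N) N * theta_sum (x * y) N * (qbin (2 * N) N * theta_sum (x / y) N) / x
   - qbin (2 * N) N ^+ 2 / x * (theta_sum (x * y) N * theta_sum (x / y) N
    - (theta_even x N * theta_odd y N - x / y * (theta_odd x N * theta_even y N))))).
  by apply: cvgB; [exact: L1|exact: Z2].
have combine (F : fieldType) (u v k t1 t2 a b c d : F) : u != 0 -> v != 0 ->
    k ^+ 2 * (a / u * b - c * (d / v)) =
    k * t1 * (k * t2) / u - k ^+ 2 / u * (t1 * t2 - (a * b - u / v * (c * d))).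
  by move=> u0 v0; field; rewrite u0 v0.
by apply/funext => N; apply: combine.
Qed.

(** The Pluecker relation for the minors of a 2 by 4 matrix, all scaled by [k], which will be the
    squared central binomial. *)
Lemma plucker2 (F : comNzRingType) (k ax bx ay b_y az bz aw bw : F) :
  k * (ax * b_y - bx * ay) * (k * (az * bw - bz * aw))
  - k * (ax * bz - bx * az) * (k * (ay * bw - b_y * aw))
  + k * (ax * bw - bx * aw) * (k * (ay * bz - b_y * az)) = 0.
Proof. by ring. Qed.

Lemma theta_pair_addition x y z w : x != 0 -> y != 0 -> z != 0 -> w != 0 ->
  thpair (Eth p) x y * thpair (Eth p) z w - thpair (Eth p) x z * thpair (Eth p) y w
  + thpair (Eth p) x w * thpair (Eth p) y z = 0.
Proof.
move=> x0 y0 z0 w0.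
pose f a b N := qbin (2 * N) N ^+ 2 *
  (theta_even a N / a * theta_odd b N - theta_odd a N * (theta_even b N / b)).
have L : ((fun N => f x y N * f z w N - f x z N * f y w N + f x w N * f y z N) @ \oo -->
    thpair (Eth p) x y * thpair (Eth p) z w - thpair (Eth p) x z * thpair (Eth p) y w
    + thpair (Eth p) x w * thpair (Eth p) y z)%classic.
  by apply: cvgD; [apply: cvgB; apply: cvgM|apply: cvgM]; exact: theta_pair_cvg.
by apply: (cvg_const_eq L) => N; apply: plucker2.
Qed.
End TripleProduct.

Lemma Eth_nome0 (R : realType) (x : CC R) : x != 0 -> Eth 0 x = 1 - x.
Proof.
move=> x0; have p1 : `|0 : CC R| < 1 by rewrite normr0.
have := Eth_cvg p1 x0; rewrite -(cvg_shiftS (Epart 0 x)) => H.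
apply: (cvg_const_eq H) => N; rewrite /Epart /= big_ord_recl big1 => [|i _].
  by rewrite /Efac expr0 expr0n /= mul0r subr0 !mulr1.
by rewrite /Efac !expr0n /= mulr0 mul0r !subr0 mulr1.
Qed.

Lemma thpair_addition (R : realType) (p x y z w : CC R) : `|p| < 1 ->
  x != 0 -> y != 0 -> z != 0 -> w != 0 ->
  thpair (Eth p) x y * thpair (Eth p) z w - thpair (Eth p) x z * thpair (Eth p) y w
  + thpair (Eth p) x w * thpair (Eth p) y z = 0.
Proof.
(* The triple product uses negative powers of [h]; for [p = 0] theta is [1 - x] and the relation is
   rational. *)
have [->|p0] := eqVneq p 0 => p1 x0 y0 z0 w0.
  rewrite /thpair !Eth_nome0 ?mulf_neq0 ?invr_neq0 //.
  have rational (F : fieldType) (x' y' z' w' : F) : x' != 0 -> y' != 0 -> z' != 0 ->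
      w' != 0 -> let f u v := (1 - u * v) * (1 - u / v) / u in
      f x' y' * f z' w' - f x' z' * f y' w' + f x' w' * f y' z' = 0.
    by move=> x'0 y'0 z'0 w'0 /=; field; rewrite x'0 y'0 z'0 w'0.
  exact: rational.
have h0 : sqrtC p != 0 by rewrite sqrtC_eq0.
have hp : `|sqrtC p ^+ 2| < 1 by rewrite sqrtCK.
by have := theta_pair_addition hp h0 x0 y0 z0 w0; rewrite sqrtCK.
Qed.

(** Together with [vwp_term], a copy of [epoch] and [omega_term] for an arbitrary function,
    convertible to them at [Eth p]; the algebra stays free of limits. *)
Definition poch_of (F : fieldType) (E : F -> F) (Q a : F) (m : nat) : F :=
  \prod_(k < m) E (a * Q ^+ k).

Definition vwp_term (F : fieldType) (E : F -> F) (Q a1 : F) (s : seq F) (k : nat) : F :=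
  E (a1 * Q ^+ (2 * k)) / E a1
  * (poch_of E Q a1 k * \prod_(x <- s) poch_of E Q x k * Q ^+ k)
  / (poch_of E Q Q k * \prod_(x <- s) poch_of E Q (a1 * Q / x) k).

(** * Theta values at monomials as an odd function of exponent vectors *)

Section Lattice.
Variables (F : fieldType) (E : F -> F) (b0 b1 b2 b3 : F).
Hypothesis E1 : E 1 = 0.
Hypothesis EV : forall x, x != 0 -> E x^-1 = - E x / x.
Hypothesis Eadd : forall x y z w, x != 0 -> y != 0 -> z != 0 -> w != 0 ->
  thpair E x y * thpair E z w - thpair E x z * thpair E y w
  + thpair E x w * thpair E y z = 0.
Hypotheses (n0 : b0 != 0) (n1 : b1 != 0) (n2 : b2 != 0) (n3 : b3 != 0).
Implicit Types P Q : {poly int}.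

(* The base points b0, b1, b2, b3 are square roots of q, a, b, d.  Exponent vectors
   are stored as the four lowest coefficients of a polynomial only to have a
   commutative ring whose unit 1 is the exponent vector of q. *)
Definition mon P : F := b0 ^ P`_0 * b1 ^ P`_1 * b2 ^ P`_2 * b3 ^ P`_3.

Lemma mon_neq0 P : mon P != 0.
Proof. by rewrite /mon !mulf_neq0 ?expfz_neq0. Qed.

Lemma monD P Q : mon (P + Q) = mon P * mon Q.
Proof.
by rewrite /mon !coefD !expfzDr //; ring.
Qed.

Lemma mon0 : mon 0 = 1.
Proof. by rewrite /mon !coef0 !expr0z !mulr1. Qed.

Lemma monN P : mon (- P) = (mon P)^-1.
Proof. by apply: (mulIf (mon_neq0 P)); rewrite -monD addNr mon0 mulVf ?mon_neq0. Qed.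

Lemma monX P (k : nat) : mon (k%:R * P) = mon P ^+ k.
Proof.
elim: k => [|k IH]; first by rewrite mul0r mon0 expr0.
by rewrite -natr1 mulrDl mul1r monD IH exprSr.
Qed.

Definition oddtheta P : F := E (mon P ^+ 2) / mon P.

Lemma oddthetaN P : oddtheta (- P) = - oddtheta P.
Proof.
rewrite /oddtheta monN exprVn EV ?expf_neq0 ?mon_neq0 // invrK.
by field; rewrite mon_neq0.
Qed.

Lemma oddtheta0 : oddtheta 0 = 0.
Proof. by rewrite /oddtheta mon0 expr1n E1 mul0r. Qed.

(** Doubling the arguments makes the product and the quotient of the two monomials squares, as in
    the definition of [oddtheta]. *)
Lemma oddtheta_pair (be x y : {poly int}) :
  thetaS oddtheta be x y = thpair E (mon (2 * x - be)) (mon (2 * y - be)).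
Proof.
rewrite /thetaS /oddtheta /thpair.
have -> : mon (2 * x - be) * mon (2 * y - be) = mon (x + y - be) ^+ 2.
  by rewrite -monD -monX; congr mon; ring.
have -> : mon (2 * x - be) / mon (2 * y - be) = mon (x - y) ^+ 2.
  by rewrite -monN -monD -monX; congr mon; ring.
have -> : mon (2 * x - be) = mon (x - y) * mon (x + y - be).
  by rewrite -monD; congr mon; ring.
by rewrite mulf_div [E (mon (x - y) ^+ 2) * _]mulrC.
Qed.

Lemma oddtheta_addition (be x y z w : {poly int}) :
  thetaS oddtheta be x y * thetaS oddtheta be z w
  - thetaS oddtheta be x z * thetaS oddtheta be y w
  + thetaS oddtheta be x w * thetaS oddtheta be y z = 0.
Proof. by rewrite !oddtheta_pair Eadd ?mon_neq0. Qed.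

Lemma E_oddtheta P : E (mon P ^+ 2) = mon P * oddtheta P.
Proof. by rewrite /oddtheta mulrC divfK ?mon_neq0. Qed.

Lemma poch_of_oddtheta t P k : poch_of E (mon t ^+ 2) (mon P ^+ 2) k =
  mon (P * k%:R + t * 'C(k, 2)%:R) * sfact oddtheta t P k.
Proof.
elim: k => [|k IH]; first by rewrite /poch_of /sfact !big_ord0 !mulr0 addr0 mon0 mulr1.
rewrite /poch_of big_ord_recr /= -/(poch_of _ _ _ _) IH sfactSr.
have -> : mon P ^+ 2 * mon t ^+ 2 ^+ k = mon (P + t * k%:R) ^+ 2.
  by rewrite -exprM mulnC exprM -exprMn monD [t * _]mulrC monX.
rewrite E_oddtheta mulrACA -monD; congr (mon _ * _).
by rewrite binS bin1; ring.
Qed.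

End Lattice.

(** * Generic parameters *)

Definition cubic_lhs_term (F : fieldType) (E : F -> F) (q a b c d e : F) (n k : nat) : F :=
     E (a * q ^+ (4 * k)) / E a
     * (poch_of E (q ^+ 3) b k * poch_of E (q ^+ 3) c k)
       / (poch_of E q (a * q / b) k * poch_of E q (a * q / c) k)
     * poch_of E q (q ^ (- n%:Z)) (2 * k) / poch_of E q (a * q ^+ n.+1) (2 * k)
     * (poch_of E q d k * poch_of E q e k)
       / (poch_of E (q ^+ 3) (a * q ^+ 3 / d) k * poch_of E (q ^+ 3) (a * q ^+ 3 / e) k)
     * q ^+ k.

Definition cubic_lhs (F : fieldType) (E : F -> F) (q a b c d e : F) (n : nat) : F :=
  \sum_(k < (n %/ 2).+1) cubic_lhs_term E q a b c d e n k.

Definition cubic_rhs (F : fieldType) (E : F -> F) (q a b c d e : F) (n : nat) : F :=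
  (poch_of E q (a * q) n * poch_of E (q ^+ 3) (a * q ^ (2%:Z - n%:Z) / b) n)
  / (poch_of E q (a * q / b) n * poch_of E (q ^+ 3) (a * q ^ (2%:Z - n%:Z)) n)
  * \sum_(k < (n %/ 3).+1) vwp_term E (q ^+ 3) (a ^+ 2 / (d * e))
      [:: b; c; a / d; a / e; q ^ (2%:Z - n%:Z); q ^ (1%:Z - n%:Z); q ^ (- n%:Z)] k.

Lemma sfact_triple (V : comNzRingType) (F : fieldType) (s : V -> F) x k :
  sfact s 1 x (3 * k) = sfact s 3 x k * (sfact s 3 (x + 1) k * sfact s 3 (x + 2) k).
Proof.
elim: k => [|k IH]; first by rewrite !sfact0 !mulr1.
rewrite (_ : 3 * k.+1 = (3 * k).+3)%N; last by ring.
rewrite !sfactSr IH (_ : x + 1 * (3 * k)%:R = x + 3 * k%:R); last by ring.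
rewrite (_ : x + 1 * (3 * k).+1%:R = x + 1 + 3 * k%:R); last by ring.
rewrite (_ : x + 1 * (3 * k).+2%:R = x + 2 + 3 * k%:R); last by ring.
by ring.
Qed.

Lemma bin2_double k : ('C(2 * k, 2) = 4 * 'C(k, 2) + k)%N.
Proof.
elim: k => [|k IH] //.
rewrite (_ : 2 * k.+1 = (2 * k).+2)%N; last by ring.
by rewrite !binS !bin1 !bin0 IH; ring.
Qed.

Section Generic.
Variables (F : fieldType) (theta : F -> F) (b0 b1 b2 b3 : F).
Hypothesis E1 : theta 1 = 0.
Hypothesis EV : forall x, x != 0 -> theta x^-1 = - theta x / x.
Hypothesis Eadd : forall x y z w, x != 0 -> y != 0 -> z != 0 -> w != 0 ->
  thpair theta x y * thpair theta z w - thpair theta x z * thpair theta y w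
  + thpair theta x w * thpair theta y z = 0.
Hypotheses (n0 : b0 != 0) (n1 : b1 != 0) (n2 : b2 != 0) (n3 : b3 != 0).
Notation mon := (mon b0 b1 b2 b3).
Notation s := (oddtheta theta b0 b1 b2 b3).
Let monD' := monD n0 n1 n2 n3.
Let monN' := monN n0 n1 n2 n3.
Let monX' := monX n0 n1 n2 n3.
Let mon_neq0' := mon_neq0 n0 n1 n2 n3.
Implicit Types P Q t : {poly int}.

Definition sqm P := mon P ^+ 2.

Lemma sqmD P Q : sqm (P + Q) = sqm P * sqm Q.
Proof. by rewrite /sqm monD' exprMn. Qed.

Lemma sqmB P Q : sqm (P - Q) = sqm P / sqm Q.
Proof. by rewrite sqmD {2}/sqm monN' exprVn. Qed.

Lemma sqmX P (k : nat) : sqm (k%:R * P) = sqm P ^+ k.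
Proof. by rewrite /sqm monX' -!exprM mulnC. Qed.

Lemma sqmXz P (k : int) : sqm (k%:~R * P) = sqm P ^ k.
Proof.
case: k => k; first by rewrite -[Posz k]/(k%:Z) -pmulrn sqmX.
rewrite NegzE mulrNz mulNr -[- _]sub0r sqmB -pmulrn sqmX -exprnN.
by rewrite /sqm -[0](subrr P) monD' monN' divff ?mon_neq0' // expr1n mul1r.
Qed.

Lemma mon_mulM P Q (u v : F) : mon P * u * (mon Q * v) = mon (P + Q) * (u * v).
Proof. by rewrite monD' mulrACA. Qed.

Lemma mon_mulV P Q (u v : F) : mon P * u / (mon Q * v) = mon (P - Q) * (u / v).
Proof. by rewrite monD' monN' invfM mulrACA. Qed.

Lemma theta_sqm P : theta (sqm P) = mon P * s P.
Proof. exact: E_oddtheta. Qed.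

Lemma poch_of_sqm t P k : poch_of theta (sqm t) (sqm P) k =
  mon (P * k%:R + t * 'C(k, 2)%:R) * sfact s t P k.
Proof. exact: poch_of_oddtheta. Qed.

Lemma sqm_1 : sqm 1 = b0 ^+ 2.
Proof. by rewrite /sqm /mon !coef1 /= !expr0z expr1z !mulr1. Qed.

Lemma sqm_X : sqm 'X = b1 ^+ 2.
Proof. by rewrite /sqm /mon !coefX /= !expr0z expr1z !mulr1 mul1r. Qed.

Lemma sqm_X2 : sqm 'X^2 = b2 ^+ 2.
Proof. by rewrite /sqm /mon !coefXn /= !expr0z expr1z !mulr1 !mul1r. Qed.

Lemma sqm_X3 : sqm 'X^3 = b3 ^+ 2.
Proof. by rewrite /sqm /mon !coefXn /= !expr0z expr1z !mul1r. Qed.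

Let q := sqm 1.
Let a := sqm 'X.
Let b := sqm 'X^2.
Let d := sqm 'X^3.
Let A : {poly int} := 'X.
Let B : {poly int} := 'X^2.
Let D : {poly int} := 'X^3.

Hypothesis gq : forall z : int, z != 0 -> theta (q ^ z) != 0.
Hypothesis ga : forall z : int, theta (a * q ^ z) != 0.
Hypothesis gab : forall z : int, theta (a / b * q ^ z) != 0.
Hypothesis gd : forall z : int, theta (d * q ^ z) != 0.
Hypothesis gad : forall z : int, theta (a / d * q ^ z) != 0.

Lemma oddtheta_neq0 P : theta (sqm P) != 0 -> s P != 0.
Proof. by rewrite theta_sqm mulf_eq0 negb_or => /andP[]. Qed.

Lemma cubic_generic (n : nat) :
  let c := a ^+ 2 * q ^+ n.+1 / b in let e := a * q ^+ n.+1 / d in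
  cubic_lhs theta q a b c d e n = cubic_rhs theta q a b c d e n.
Proof.
move=> c e; pose C : {poly int} := 2 * A + n%:R + 1 - B.
pose E : {poly int} := A + n%:R + 1 - D.
have cE : c = sqm C.
  by rewrite /c /C -!sqmX -sqmD -sqmB; congr sqm; rewrite /A /B; ring.
have eE : e = sqm E.
  by rewrite /e /E -!sqmX -sqmD -sqmB; congr sqm; rewrite /A /D; ring.
have q3 : q ^+ 3 = sqm 3 by rewrite -sqmX; congr sqm; rewrite ?/C ?/E ?/A ?/B ?/D; ring.
have gz : forall z : int, sqm z%:~R = q ^ z by move=> z; rewrite -sqmXz mulr1.
have gzA P (z : int) : sqm (P + z%:~R) = sqm P * q ^ z by rewrite sqmD gz.
have nzZ (z : int) : z != 0 -> s z%:~R != 0.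
  by move=> z0; apply: oddtheta_neq0; rewrite gz gq.
have nzA (z : int) : s (A + z%:~R) != 0 by apply: oddtheta_neq0; rewrite gzA ga.
have nzAB (z : int) : s (A - B + z%:~R) != 0.
  by apply: oddtheta_neq0; rewrite gzA sqmB gab.
have nzD (z : int) : s (D + z%:~R) != 0 by apply: oddtheta_neq0; rewrite gzA gd.
have nzAD (z : int) : s (A - D + z%:~R) != 0.
  by apply: oddtheta_neq0; rewrite gzA sqmB gad.
have main := @additive_cubic_transformation _ _ s (oddthetaN EV n0 n1 n2 n3)
  (oddtheta0 b0 b1 b2 b3 E1) (oddtheta_addition Eadd n0 n1 n2 n3) nzZ A B C D E n
  (erefl C) (erefl E) nzA nzAB nzD nzAD.
(* The trailing [* 1] gives the shape [mon P * u], so that [mon_mulM] collects this power as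
   well. *)
have qX (k : nat) : q ^+ k = mon (2 * k%:R) * 1.
  by rewrite mulr1 -exprM -monX'; congr mon; ring.
have hn : q ^ (- n%:Z) = sqm (- n%:R) by rewrite -gz; congr sqm; rewrite ?/C ?/E ?/A ?/B ?/D; ring.
have h4 : a * q ^+ n.+1 = sqm (A + n%:R + 1).
  by rewrite -sqmX -sqmD; congr sqm; rewrite ?/C ?/E ?/A ?/B ?/D; ring.
have hab : a * q / b = sqm (A - B + 1) by rewrite -sqmD -sqmB; congr sqm; rewrite ?/C ?/E ?/A ?/B ?/D; ring.
have hac : a * q / c = sqm (A - C + 1) by rewrite cE -sqmD -sqmB; congr sqm; rewrite ?/C ?/E ?/A ?/B ?/D; ring.
have had : a * q ^+ 3 / d = sqm (A - D + 3) by rewrite q3 -sqmD -sqmB; congr sqm; rewrite ?/C ?/E ?/A ?/B ?/D; ring.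
have hae : a * q ^+ 3 / e = sqm (A - E + 3).
  by rewrite q3 eE -sqmD -sqmB; congr sqm; rewrite ?/C ?/E ?/A ?/B ?/D; ring.
have -> : cubic_lhs theta q a b c d e n = \sum_(k < (n %/ 2).+1)
    lhs_factor s A n k * bpart_lhs s A B C k
    * (sfact s 1 D k * sfact s 1 E k / (sfact s 3 (A - D + 3) k * sfact s 3 (A - E + 3) k)).
  apply: eq_bigr => k _; rewrite /cubic_lhs_term.
  have h1 : a * q ^+ (4 * k) = sqm (A + 4 * k%:R).
    by rewrite -sqmX -sqmD; congr sqm; rewrite ?/C ?/E ?/A ?/B ?/D; ring.
  rewrite h1 hab hac hn h4 had hae q3 cE eE qX !theta_sqm !poch_of_sqm.
  rewrite !(mon_mulM, mon_mulV).
  (* [M] is the total exponent of the monomials in one term; it cancels thanks to the factor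
     [q ^+ k] and the values of [C] and [E]. *)
  set M := (X in mon X); have -> : M = 0.
    by rewrite /M bin2_double /C /E /A /B /D; ring.
  rewrite (@mon0 F b0 b1 b2 b3) mul1r mulr1.
  rewrite /lhs_factor /bpart_lhs.
  have regroup (s1 s0 x1 x2 x3 x4 x5 x6 : F) :
    s1 / s0 * x1 / x2 * x3 / x4 * x5 / x6 = s1 / s0 * x3 / x4 * (x1 / x2) * (x5 / x6).
    by ring.
  exact: regroup.
rewrite main /cubic_rhs; congr (_ * _).
  have hb2 : a * q ^ (2%:Z - n%:Z) / b = sqm (A - n%:R + 2 - B).
    by rewrite -gz -sqmD -sqmB; congr sqm; rewrite ?/C ?/E ?/A ?/B ?/D; ring.
  have h2 : a * q ^ (2%:Z - n%:Z) = sqm (A - n%:R + 2).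
    by rewrite -gz -sqmD; congr sqm; rewrite ?/C ?/E ?/A ?/B ?/D; ring.
  rewrite hb2 hab h2 q3 -sqmD !poch_of_sqm !(mon_mulM, mon_mulV).
  set M := (X in mon X); have -> : M = 0 by rewrite /M /A /B /D; ring.
  rewrite (@mon0 F b0 b1 b2 b3) mul1r; have regroup (x y z w : F) :
    x / y * (z / w) = x * z / (w * y) by rewrite mulf_div (mulrC y).
  exact: regroup.
apply: eq_bigr => j _; rewrite /vwp_term !big_cons !big_nil !mulr1.
have hA1 : a ^+ 2 / (d * e) = sqm (A - n%:R - 1).
  by rewrite eE -sqmX -sqmD -sqmB; congr sqm; rewrite /E /A /D; ring.
have hA1k : sqm (A - n%:R - 1) * q ^+ 3 ^+ (2 * j) = sqm (A - n%:R - 1 + 6 * j%:R).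
  by rewrite -exprM -sqmX -sqmD; congr sqm; rewrite ?/C ?/E ?/A ?/B ?/D; ring.
have hQ (P : {poly int}) : sqm (A - n%:R - 1) * q ^+ 3 / sqm P = sqm (A - n%:R + 2 - P).
  by rewrite q3 -sqmD -sqmB; congr sqm; rewrite ?/C ?/E ?/A ?/B ?/D; ring.
have h1n : q ^ (1%:Z - n%:Z) = sqm (- n%:R + 1) by rewrite -gz; congr sqm; rewrite ?/C ?/E ?/A ?/B ?/D; ring.
have h2n : q ^ (2%:Z - n%:Z) = sqm (- n%:R + 2) by rewrite -gz; congr sqm; rewrite ?/C ?/E ?/A ?/B ?/D; ring.
have q3X (k : nat) : q ^+ 3 ^+ k = mon (6 * k%:R) * 1.
  by rewrite -exprM qX; congr (mon _ * _); ring.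
rewrite hA1 hA1k cE eE hn h1n h2n -!(sqmB A) !hQ q3X.
(* Well-poised partners: those of [a/d] and [a/e] are the denominators with [e] and [d], and those
   of the three powers of [q] are [a], [aq], [aq^2], merged by [sfact_triple]. *)
rewrite (_ : A - n%:R + 2 - (A - D) = A - E + 3); last by rewrite /E /A /D; ring.
rewrite (_ : A - n%:R + 2 - (A - E) = A - D + 3); last by rewrite /E /A /D; ring.
rewrite (_ : A - n%:R + 2 - (- n%:R + 2) = A); last by ring.
rewrite (_ : A - n%:R + 2 - (- n%:R + 1) = A + 1); last by ring.
rewrite (_ : A - n%:R + 2 - (- n%:R) = A + 2); last by ring.
rewrite q3 !theta_sqm !poch_of_sqm !(mon_mulM, mon_mulV).
set M := (X in mon X); have -> : M = 0 by rewrite /M /C /E /A /B /D; ring.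
rewrite (@mon0 F b0 b1 b2 b3) mul1r !mulr1 /rhs_factor !sfact_triple.
have regroup (s1 s0 x0 xb xc xd xe x1 x2 x3 y0 yb yc yd ye y1 y2 y3 : F) :
  s1 / s0 * x0 / y0 * (x1 * (x2 * x3)) / (y1 * (y2 * y3)) * (xb * xc / (yb * yc))
    * (xd * xe / (yd * ye))
  = s1 / s0 * (x0 * (xb * (xc * (xd * (xe * (x3 * (x2 * x1)))))))
    / (y0 * (yb * (yc * (ye * (yd * (y1 * (y2 * y3))))))).
  by rewrite !invfM; ring.
exact: regroup.
Qed.
End Generic.

(** * Perturbation to generic parameters *)

Lemma cubic_generic_params (R : realType) (p q a b d : CC R) (n : nat) :
  `|p| < 1 -> q != 0 -> a != 0 -> b != 0 -> d != 0 ->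
  (forall z : int, z != 0 -> Eth p (q ^ z) != 0) ->
  (forall z : int, Eth p (a * q ^ z) != 0) ->
  (forall z : int, Eth p (a / b * q ^ z) != 0) ->
  (forall z : int, Eth p (d * q ^ z) != 0) ->
  (forall z : int, Eth p (a / d * q ^ z) != 0) ->
  let c := a ^+ 2 * q ^+ n.+1 / b in let e := a * q ^+ n.+1 / d in
  cubic_lhs (Eth p) q a b c d e n = cubic_rhs (Eth p) q a b c d e n.
Proof.
move=> p1 q0 a0 b0 d0 gq ga gab gd gad.
have sq (x : CC R) : x != 0 -> sqrtC x != 0 by rewrite sqrtC_eq0.
have := cubic_generic (Eth1 p) (Eth_inv p1) (fun x y z w => thpair_addition p1)
  (sq _ q0) (sq _ a0) (sq _ b0) (sq _ d0).
rewrite sqm_1 sqm_X sqm_X2 sqm_X3 !sqrtCK => H; exact: H.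
Qed.

Lemma epochE (R : realType) (p : CC R) : epoch p = poch_of (Eth p).
Proof. by []. Qed.

Lemma omega_termE (R : realType) (p : CC R) : omega_term p = vwp_term (Eth p).
Proof. by []. Qed.

Section Perturbation.
Variables (R : realType) (p : CC R).
Hypothesis p1 : `|p| < 1.

(** A countable set has Lebesgue measure 0, while the interval has measure [eps]. *)
Lemma countable_avoid (S : set R) (eps : R) : countable S -> 0 < eps ->
  exists s : R, [/\ 1 < s, s < 1 + eps & ~ S s].
Proof.
move=> cS e0; apply: contrapT => H.
have sub : (`]1, 1 + eps[ `<=` S)%classic.
  move=> s /=; rewrite in_itv /= => /andP[s1 s2]; apply: contrapT => Ss.
  by apply: H; exists s.
have := countable_lebesgue_measure0 (sub_countable (subset_card_le sub) cS).
rewrite lebesgue_measure_itv /= lte_fin ltrDl e0 -EFinD => /eqP.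
by rewrite eqe addrAC subrr add0r gt_eqF.
Qed.

Lemma countable_subsingleton (S : set R) :
  (forall x y, S x -> S y -> x = y) -> countable S.
Proof.
move=> H; have [->|/set0P[x Sx]] := eqVneq S set0; first exact: countable0.
rewrite (_ : S = [set x])%classic; first exact: countable1.
by apply/seteqP; split=> [y Sy|y ->] //=; apply: H.
Qed.

(* The zeros of E lie on countably many circles. *)
Lemma theta_avoid (T : countType) (y : T -> CC R) (z : T -> int) (eps : R) :
  (forall i, y i != 0) -> (forall i, z i != 0) -> 0 < eps ->
  exists s : R, [/\ 1 < s, s < 1 + eps & forall i, Eth p (y i * s%:C%C ^ z i) != 0].
Proof.
move=> y0 z0 e0; pose r := modc p.
(* The boolean selects one of the two families of zeros in [Eth_eq0]. Each set has at most one
   point, since a nonzero power is injective on positive reals. *)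
pose bad (j : T * (nat * bool)) : set R := [set s : R | 0 < s /\
  modc (y j.1) * s ^ z j.1 * (if j.2.2 then r ^+ j.2.1 else 1)
  = (if j.2.2 then 1 else r ^+ j.2.1.+1)]%classic.
have cbad j : countable (bad j).
  apply: countable_subsingleton => x w [x0 hx] [w0 hw].
  have m0 : modc (y j.1) != 0 by rewrite modc_eq0.
  set u := (if j.2.2 then r ^+ j.2.1 else 1) in hx hw.
  (* For [p = 0] the factor [r ^+ k] can be 0, but the defining equation would then read 0 = 1. *)
  have u0 : u != 0.
    move: hx; rewrite /u; case: j.2.2; last by rewrite oner_eq0.
    by move=> hx; apply: contra_eq_neq hx => ->; rewrite mulr0 eq_sym oner_eq0.
  apply: (pexpIrz (z0 j.1)); rewrite ?nnegrE ?(ltW x0) ?(ltW w0) //.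
  by apply: (mulfI m0); apply: (mulIf u0); rewrite hx hw.
have cb : countable (\bigcup_j bad j)%classic.
  by apply: bigcup_countable => //; apply: countableP.
have [s [s1 s2 Hs]] := countable_avoid cb e0; exists s; split=> // i.
have s0 : 0 < s by apply: lt_trans s1.
have sC : s%:C%C != 0 :> CC R by rewrite -modc_eq0 modc_realC ?gt_eqF // ltW.
apply/eqP => E0; apply: Hs.
have x0 : y i * s%:C%C ^ z i != 0 by rewrite mulf_neq0 ?expfz_neq0.
have [k] := Eth_eq0 p1 x0 E0; rewrite modcM modcXz modc_realC ?(ltW s0) // => -[h|h].
  by exists (i, (k, true)) => //; split.
by exists (i, (k, false)) => //; split=> //=; rewrite mulr1.
Qed.

Definition generic_params (q a b d : CC R) : Prop :=
  [/\ [/\ q != 0, a != 0, b != 0 & d != 0],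
      (forall z : int, z != 0 -> Eth p (q ^ z) != 0),
      (forall z : int, Eth p (a * q ^ z) != 0),
      (forall z : int, Eth p (a / b * q ^ z) != 0) &
      (forall z : int, Eth p (d * q ^ z) != 0 /\ Eth p (a / d * q ^ z) != 0)].

(** The parameter moves along its ray, [x' = x s] with [s] real; [z i] is the exponent with which it
    enters the condition [i]. *)
Lemma theta_avoid_near (T : countType) (y : T -> CC R) (z : T -> int) (x : CC R) (eps : R) :
  (forall i, y i != 0) -> (forall i, z i != 0) -> x != 0 -> 0 < eps ->
  exists x', [/\ x' != 0, modc (x' - x) < eps
    & forall i, Eth p (y i * (x' / x) ^ z i) != 0].
Proof.
move=> y0 z0 x0 e0.
have mx : 0 < modc x by rewrite modc_gt0.
have [s [s1 s2 Hs]] := theta_avoid y0 z0 (divr_gt0 e0 mx).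
have s0 : 0 <= s - 1 by rewrite subr_ge0 ltW.
exists (x * s%:C%C); split.
- by rewrite mulf_neq0 // -modc_eq0 modc_realC ?gt_eqF ?(lt_trans _ s1) // ltW // (lt_trans _ s1).
- rewrite (_ : _ - x = x * (s - 1)%:C%C); last by rewrite rmorphB mulrBr mulr1.
  by rewrite modcM modc_realC // mulrC -ltr_pdivlMr // ltrBlDl.
by move=> i; rewrite [x * _]mulrC mulfK.
Qed.

Lemma generic_params_dense (q a b d : CC R) (eps : R) :
  q != 0 -> a != 0 -> b != 0 -> d != 0 -> 0 < eps ->
  exists q' a' b' d', generic_params q' a' b' d' /\
   [/\ modc (q' - q) < eps, modc (a' - a) < eps, modc (b' - b) < eps & modc (d' - d) < eps].
Proof.
move=> q0 a0 b0 d0 e0.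
(* The condition on [q] excludes [z = 0]; the value 1 there keeps all exponents nonzero. *)
pose zq (z : int) := if z == 0 then 1 else z.
have zq0 z : zq z != 0 by rewrite /zq; case: (eqVneq z 0).
have yq0 z : q ^ zq z != 0 by rewrite expfz_neq0.
have [q' [q'0 qq' gq]] := theta_avoid_near yq0 zq0 q0 e0.
have ya0 z : a * q' ^ z != 0 by rewrite mulf_neq0 ?expfz_neq0.
have [a' [a'0 aa' ga]] := @theta_avoid_near int _ (fun=> 1) _ _ ya0 (fun=> isT) a0 e0.
have yb0 z : a' / b * q' ^ z != 0 by rewrite !mulf_neq0 ?invr_eq0 ?expfz_neq0.
have [b' [b'0 bb' gb]] := @theta_avoid_near int _ (fun=> -1) _ _ yb0 (fun=> isT) b0 e0.
(* One choice of [d'] must meet both families of conditions, where [d] enters with exponents 1 and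
   -1. *)
pose yd (i : int * bool) := if i.2 then d * q' ^ i.1 else a' / d * q' ^ i.1.
have yd0 i : yd i != 0.
  by rewrite /yd; case: i.2; rewrite !mulf_neq0 ?invr_eq0 ?expfz_neq0.
pose zd (i : int * bool) : int := if i.2 then 1 else -1.
have zd0 i : zd i != 0 by rewrite /zd; case: i.2.
have [d' [d'0 dd' gd]] := theta_avoid_near yd0 zd0 d0 e0.
have inv (x y u v : CC R) : x != 0 -> y != 0 -> u / x * v * (y / x) ^ (-1) = u / y * v.
  move=> x0 y0; rewrite -[_ ^ (-1)]/((y / x)^-1) invf_div.
  by rewrite mulrAC mulrA divfK // .
exists q', a', b', d'; split; split=> //.
- move=> z z0; have := gq z; rewrite /zq (negPf z0) expfzMl exprz_inv.
  by rewrite mulrCA -expfzDr // subrr expr0z mulr1.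
- by move=> z; have := ga z; rewrite expr1z mulrAC mulrCA mulfV // mulr1.
- by move=> z; have := gb z; rewrite inv.
- move=> z; split; first by have := gd (z, true); rewrite /yd /zd /= expr1z mulrAC mulrCA mulfV // mulr1.
  by have := gd (z, false); rewrite /yd /zd /= inv.
Qed.


(** * Sequential continuity of both sides where no denominator vanishes *)

Local Notation "u ~> l" := (u @ \oo --> (l : CC R))%classic (at level 70).

Lemma cvg_eqf (u v : nat -> CC R) (l m : CC R) :
  v ~> m -> (forall t, u t = v t) -> l = m -> u ~> l.
Proof. by move=> vm /funext -> ->. Qed.

Lemma cvgMf (u v : nat -> CC R) (l m : CC R) :
  u ~> l -> v ~> m -> (fun t => u t * v t) ~> l * m.
Proof. exact: cvgM. Qed.

Lemma cvgDf (u v : nat -> CC R) (l m : CC R) :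
  u ~> l -> v ~> m -> (fun t => u t + v t) ~> l + m.
Proof. exact: cvgD. Qed.

Lemma cvgBf (u v : nat -> CC R) (l m : CC R) :
  u ~> l -> v ~> m -> (fun t => u t - v t) ~> l - m.
Proof. exact: cvgB. Qed.

Lemma cvg_divf (u v : nat -> CC R) (l m : CC R) :
  m != 0 -> u ~> l -> v ~> m -> (fun t => u t / v t) ~> l / m.
Proof. by move=> m0 ul vm; apply: (cvgMf ul); exact: (cvgV m0 vm). Qed.

Lemma cvg_expf (u : nat -> CC R) (l : CC R) k : u ~> l -> (fun t => u t ^+ k) ~> l ^+ k.
Proof.
move=> ul; elim: k => [|k IH]; first exact: cvg_cst.
by apply: (cvg_eqf (cvgMf ul IH)) => [t|]; rewrite exprS.
Qed.

Arguments cvg_expf [u l] k.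

Lemma cvg_exprzf (u : nat -> CC R) (l : CC R) (z : int) :
  l != 0 -> u ~> l -> (fun t => u t ^ z) ~> l ^ z.
Proof.
move=> l0 ul; case: z => k; first exact: cvg_expf.
by apply: cvgV; [rewrite expf_neq0|exact: cvg_expf].
Qed.

Arguments cvg_exprzf [u l] z.

Lemma cvg_sumf (f : nat -> nat -> CC R) (l : nat -> CC R) K :
  (forall k, (k < K)%N -> (fun t => f t k) ~> l k) ->
  (fun t => \sum_(k < K) f t k) ~> \sum_(k < K) l k.
Proof.
elim: K => [|K IH] H.
  have cst0 : (fun=> 0) ~> 0 by exact: cvg_cst.
  by apply: (cvg_eqf cst0) => [t|]; rewrite big_ord0.
have H1 : forall k, (k < K)%N -> (fun t => f t k) ~> l k.
  by move=> k kK; apply: (H k (leqW kK)).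
by apply: (cvg_eqf (cvgDf (IH H1) (H K (ltnSn K)))) => [t|]; rewrite big_ord_recr.
Qed.

Lemma cvg_Eth (u : nat -> CC R) (l : CC R) :
  l != 0 -> u ~> l -> (fun t => Eth p (u t)) ~> Eth p l.
Proof. exact: Eth_seq_continuous. Qed.

Lemma cvg_epoch (Q x : nat -> CC R) (Ql xl : CC R) k :
  Ql != 0 -> xl != 0 -> Q ~> Ql -> x ~> xl ->
  (fun t => epoch p (Q t) (x t) k) ~> epoch p Ql xl k.
Proof.
move=> Q0 x0 HQ Hx; rewrite /epoch; elim: k => [|k IH].
  have cst1 : (fun=> 1) ~> 1 by exact: cvg_cst.
  by apply: (cvg_eqf cst1) => [t|]; rewrite big_ord0.
have Hk := cvgMf Hx (cvg_expf k HQ).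
have k0 : xl * Ql ^+ k != 0 by rewrite mulf_neq0 ?expf_neq0.
by apply: (cvg_eqf (cvgMf IH (cvg_Eth k0 Hk))) => [t|]; rewrite big_ord_recr.
Qed.

Arguments cvg_epoch [Q x Ql xl] k.

(** Pairs of a sequence and its nonzero limit, so that induction on the list treats all parameters
    of the omega series alike. *)
Definition cvg_list (s : seq ((nat -> CC R) * CC R)) : Prop :=
  foldr (fun g P => [/\ g.1 ~> g.2, g.2 != 0 & P]) True s.

Lemma cvg_omega_term (Q A : nat -> CC R) (Ql Al : CC R) s k :
  Ql != 0 -> Al != 0 -> Q ~> Ql -> A ~> Al -> cvg_list s ->
  Eth p Al != 0 ->
  epoch p Ql Ql k * \prod_(x <- [seq g.2 | g <- s]) epoch p Ql (Al * Ql / x) k != 0 ->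
  (fun t => omega_term p (Q t) (A t) [seq g.1 t | g <- s] k)
    ~> omega_term p Ql Al [seq g.2 | g <- s] k.
Proof.
move=> Q0 A0 HQ HA Hs EA den; rewrite /omega_term.
have cst1 : (fun=> 1) ~> 1 by exact: cvg_cst.
have num : (fun t => \prod_(x <- [seq g.1 t | g <- s]) epoch p (Q t) x k)
    ~> \prod_(x <- [seq g.2 | g <- s]) epoch p Ql x k.
  elim: s Hs {den} => [_|g s IH [gl g0 Hs]] /=.
    by apply: (cvg_eqf cst1) => [t|]; rewrite big_nil.
  have L := cvgMf (cvg_epoch k Q0 g0 HQ gl) (IH Hs).
  by apply: (cvg_eqf L) => [t|]; rewrite big_cons.
have dnm : (fun t => \prod_(x <- [seq g.1 t | g <- s]) epoch p (Q t) (A t * Q t / x) k)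
    ~> \prod_(x <- [seq g.2 | g <- s]) epoch p Ql (Al * Ql / x) k.
  elim: s Hs {den num} => [_|g s IH [gl g0 Hs]] /=.
    by apply: (cvg_eqf cst1) => [t|]; rewrite big_nil.
  have x0 : Al * Ql / g.2 != 0 by rewrite !mulf_neq0 ?invr_eq0.
  have Hx := cvg_divf g0 (cvgMf HA HQ) gl.
  have L := cvgMf (cvg_epoch k Q0 x0 HQ Hx) (IH Hs).
  by apply: (cvg_eqf L) => [t|]; rewrite big_cons.
have AQ0 : Al * Ql ^+ (2 * k) != 0 by rewrite mulf_neq0 ?expf_neq0.
have E1 := cvg_Eth AQ0 (cvgMf HA (cvg_expf (2 * k) HQ)).
have E2 := cvg_divf EA E1 (cvg_Eth A0 HA).
have N := cvgMf (cvgMf (cvg_epoch k Q0 A0 HQ HA) num) (cvg_expf k HQ).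
have D := cvgMf (cvg_epoch k Q0 Q0 HQ HQ) dnm.
exact: (cvg_divf den (cvgMf E2 N) D).
Qed.

Section Limit.
Variables (q a b c d e : nat -> CC R) (ql al bl cl dl el : CC R) (n : nat).
Hypotheses (q0 : ql != 0) (a0 : al != 0) (b0 : bl != 0) (c0 : cl != 0)
  (d0 : dl != 0) (e0 : el != 0).
Hypotheses (Hq : q ~> ql) (Ha : a ~> al) (Hb : b ~> bl) (Hc : c ~> cl)
  (Hd : d ~> dl) (He : e ~> el).

Let q30 : ql ^+ 3 != 0. Proof. by rewrite expf_neq0. Qed.
Let Hq3 : (fun t => q t ^+ 3) ~> ql ^+ 3. Proof. exact: cvg_expf. Qed.

Lemma cubic_lhs_cvg : Eth p al != 0 ->
  (forall k : nat, (k <= n %/ 2)%N ->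
     epoch p ql (al * ql / bl) k * epoch p ql (al * ql / cl) k
     * epoch p ql (al * ql ^+ n.+1) (2 * k)
     * epoch p (ql ^+ 3) (al * ql ^+ 3 / dl) k * epoch p (ql ^+ 3) (al * ql ^+ 3 / el) k
     != 0) ->
  (fun t => cubic_lhs (Eth p) (q t) (a t) (b t) (c t) (d t) (e t) n)
    ~> cubic_lhs (Eth p) ql al bl cl dl el n.
Proof.
move=> Ea Hk; rewrite /cubic_lhs.
apply: (cvg_sumf (f := fun t => cubic_lhs_term (Eth p) (q t) (a t) (b t) (c t) (d t) (e t) n)
  (l := cubic_lhs_term (Eth p) ql al bl cl dl el n)) => k; rewrite ltnS => kn.
rewrite /cubic_lhs_term -(epochE p).
have := Hk k kn; rewrite !mulf_eq0 !negb_or => /andP[/andP[/andP[/andP[h1 h2] h3] h4] h5].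
have aX0 m : al * ql ^+ m != 0 by rewrite mulf_neq0 ?expf_neq0.
have aX m := cvgMf Ha (cvg_expf m Hq).
have z0 : ql ^ (- n%:Z) != 0 by rewrite expfz_neq0.
have den1 x xl (x0 : xl != 0) (Hx : x ~> xl) :
    (fun t => epoch p (q t) (a t * q t / x t) k) ~> epoch p ql (al * ql / xl) k.
  have nz : al * ql / xl != 0 by rewrite !mulf_neq0 ?invr_eq0.
  exact: (cvg_epoch k q0 nz Hq (cvg_divf x0 (cvgMf Ha Hq) Hx)).
have den3 x xl (x0 : xl != 0) (Hx : x ~> xl) :
    (fun t => epoch p (q t ^+ 3) (a t * q t ^+ 3 / x t) k)
    ~> epoch p (ql ^+ 3) (al * ql ^+ 3 / xl) k.
  have nz : al * ql ^+ 3 / xl != 0 by rewrite !mulf_neq0 ?invr_eq0.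
  exact: (cvg_epoch k q30 nz Hq3 (cvg_divf x0 (cvgMf Ha Hq3) Hx)).
have L1 := cvg_divf Ea (cvg_Eth (aX0 (4 * k)%N) (aX (4 * k)%N)) (cvg_Eth a0 Ha).
have L2 := cvgMf L1 (cvgMf (cvg_epoch k q30 b0 Hq3 Hb) (cvg_epoch k q30 c0 Hq3 Hc)).
have L3 := cvg_divf (mulf_neq0 h1 h2) L2 (cvgMf (den1 _ _ b0 Hb) (den1 _ _ c0 Hc)).
have L4 := cvgMf L3 (cvg_epoch (2 * k) q0 z0 Hq (cvg_exprzf (- n%:Z) q0 Hq)).
have L5 := cvg_divf h3 L4 (cvg_epoch (2 * k) q0 (aX0 n.+1) Hq (aX n.+1)).
have L6 := cvgMf L5 (cvgMf (cvg_epoch k q0 d0 Hq Hd) (cvg_epoch k q0 e0 Hq He)).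
have L7 := cvg_divf (mulf_neq0 h4 h5) L6 (cvgMf (den3 _ _ d0 Hd) (den3 _ _ e0 He)).
exact: (cvgMf L7 (cvg_expf k Hq)).
Qed.

Lemma cubic_rhs_cvg :
  epoch p ql (al * ql / bl) n * epoch p (ql ^+ 3) (al * ql ^ (2%:Z - n%:Z)) n != 0 ->
  Eth p (al ^+ 2 / (dl * el)) != 0 ->
  (forall k : nat, (k <= n %/ 3)%N ->
     epoch p (ql ^+ 3) (ql ^+ 3) k
     * \prod_(x <- [:: bl; cl; al / dl; al / el;
                      ql ^ (2%:Z - n%:Z); ql ^ (1%:Z - n%:Z); ql ^ (- n%:Z)])
         epoch p (ql ^+ 3) (al ^+ 2 / (dl * el) * ql ^+ 3 / x) k
     != 0) ->
  (fun t => cubic_rhs (Eth p) (q t) (a t) (b t) (c t) (d t) (e t) n)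
    ~> cubic_rhs (Eth p) ql al bl cl dl el n.
Proof.
move=> h1 h2 Hk; rewrite /cubic_rhs -(epochE p) -(omega_termE p).
have qz z := cvg_exprzf z q0 Hq.
have qz0 z : ql ^ z != 0 by rewrite expfz_neq0.
have aqz z := cvgMf Ha (qz z).
have aqz0 z : al * ql ^ z != 0 by rewrite mulf_neq0.
have aq0 : al * ql != 0 by rewrite mulf_neq0.
have aq := cvgMf Ha Hq.
have n1 : al * ql ^ (2%:Z - n%:Z) / bl != 0 by rewrite mulf_neq0 ?invr_eq0.
have n2 : al * ql / bl != 0 by rewrite mulf_neq0 ?invr_eq0.
have P1 := cvgMf (cvg_epoch n q0 aq0 Hq aq)
  (cvg_epoch n q30 n1 Hq3 (cvg_divf b0 (aqz (2%:Z - n%:Z)) Hb)).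
have P2 := cvgMf (cvg_epoch n q0 n2 Hq (cvg_divf b0 aq Hb))
  (cvg_epoch n q30 (aqz0 (2%:Z - n%:Z)) Hq3 (aqz (2%:Z - n%:Z))).
have de0 : dl * el != 0 by rewrite mulf_neq0.
have A0 : al ^+ 2 / (dl * el) != 0 by rewrite mulf_neq0 ?invr_eq0 ?expf_neq0.
have HA := cvg_divf de0 (cvg_expf 2 Ha) (cvgMf Hd He).
have ad0 : al / dl != 0 by rewrite mulf_neq0 ?invr_eq0.
have ae0 : al / el != 0 by rewrite mulf_neq0 ?invr_eq0.
have Hs : cvg_list [:: (b, bl); (c, cl); (fun t => a t / d t, al / dl);
   (fun t => a t / e t, al / el); (fun t => q t ^ (2%:Z - n%:Z), ql ^ (2%:Z - n%:Z));
   (fun t => q t ^ (1%:Z - n%:Z), ql ^ (1%:Z - n%:Z));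
   (fun t => q t ^ (- n%:Z), ql ^ (- n%:Z))].
  split; [exact Hb|exact b0|split; [exact Hc|exact c0|]].
  split; [exact: (cvg_divf d0 Ha Hd)|exact ad0|].
  split; [exact: (cvg_divf e0 Ha He)|exact ae0|].
  by split; [exact: qz|exact: qz0|split; [exact: qz|exact: qz0|split; [exact: qz|exact: qz0|]]].
have S := cvg_sumf (fun k (kn : (k < (n %/ 3).+1)%N) =>
  cvg_omega_term q30 A0 Hq3 HA Hs h2 (Hk k kn)).
exact: (cvgMf (cvg_divf h1 P1 P2) S).
Qed.

End Limit.

End Perturbation.

Theorem theorem4p8 (R : realType) (p q a b c d e : CC R) (n : nat) :
  `|p| < 1 -> q != 0 ->
  a != 0 -> b != 0 -> c != 0 -> d != 0 -> e != 0 ->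
  b * c = a ^+ 2 * q ^+ n.+1 ->
  d * e = a * q ^+ n.+1 ->
  (* genericity: no denominator vanishes *)
  Eth p a != 0 ->
  (forall k : nat, (k <= n %/ 2)%N ->
     epoch p q (a * q / b) k * epoch p q (a * q / c) k
     * epoch p q (a * q ^+ n.+1) (2 * k)
     * epoch p (q ^+ 3) (a * q ^+ 3 / d) k * epoch p (q ^+ 3) (a * q ^+ 3 / e) k
     != 0) ->
  epoch p q (a * q / b) n * epoch p (q ^+ 3) (a * q ^ (2%:Z - n%:Z)) n != 0 ->
  Eth p (a ^+ 2 / (d * e)) != 0 ->
  (forall k : nat, (k <= n %/ 3)%N ->
     epoch p (q ^+ 3) (q ^+ 3) k
     * \prod_(x <- [:: b; c; a / d; a / e;
                      q ^ (2%:Z - n%:Z); q ^ (1%:Z - n%:Z); q ^ (- n%:Z)])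
         epoch p (q ^+ 3) (a ^+ 2 / (d * e) * q ^+ 3 / x) k
     != 0) ->
  \sum_(k < (n %/ 2).+1)
     Eth p (a * q ^+ (4 * k)) / Eth p a
     * (epoch p (q ^+ 3) b k * epoch p (q ^+ 3) c k)
       / (epoch p q (a * q / b) k * epoch p q (a * q / c) k)
     * epoch p q (q ^ (- n%:Z)) (2 * k) / epoch p q (a * q ^+ n.+1) (2 * k)
     * (epoch p q d k * epoch p q e k)
       / (epoch p (q ^+ 3) (a * q ^+ 3 / d) k * epoch p (q ^+ 3) (a * q ^+ 3 / e) k)
     * q ^+ k
  =
  (epoch p q (a * q) n * epoch p (q ^+ 3) (a * q ^ (2%:Z - n%:Z) / b) n)
  / (epoch p q (a * q / b) n * epoch p (q ^+ 3) (a * q ^ (2%:Z - n%:Z)) n)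
  * omega_term_sum (n %/ 3) p (q ^+ 3) (a ^+ 2 / (d * e))
      [:: b; c; a / d; a / e; q ^ (2%:Z - n%:Z); q ^ (1%:Z - n%:Z); q ^ (- n%:Z)].
Proof.
move=> p1 q0 a0 b0 c0 d0 e0 bc de Ea Hl Hr EA Ho.
rewrite -/(cubic_lhs (Eth p) q a b c d e n) -/(cubic_rhs (Eth p) q a b c d e n).
have near t : exists x : CC R * CC R * CC R * CC R,
    generic_params p x.1.1.1 x.1.1.2 x.1.2 x.2 /\
    [/\ modc (x.1.1.1 - q) < (1 / 2) ^+ t, modc (x.1.1.2 - a) < (1 / 2) ^+ t,
        modc (x.1.2 - b) < (1 / 2) ^+ t & modc (x.2 - d) < (1 / 2) ^+ t].
  have eps : 0 < (1 / 2) ^+ t :> R by rewrite exprn_gt0 // divr_gt0.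
  have [q' [a' [b' [d' H]]]] := generic_params_dense p1 q0 a0 b0 d0 eps.
  by exists (q', a', b', d').
have [x Hx] := choice near.
have half : 0 <= (1 / 2 : R) < 1 by apply/andP; split; lra.
have tends (u : nat -> CC R) (l : CC R) : (forall t, modc (u t - l) < (1 / 2) ^+ t) ->
    (u @ \oo --> l)%classic.
  move=> Hu; apply/cvg_modcP => eps eps0.
  have [N HN] := @geometric_small R 1 (1 / 2) eps half eps0; exists N => t Nt.
  apply: lt_trans (Hu t) _; have := HN t Nt.
  by rewrite mul1r; apply: le_lt_trans; apply: ler_norm.
have Hq : ((fun t => (x t).1.1.1) @ \oo --> q)%classic.
  by apply: tends => t; have [_ []] := Hx t.
have Ha : ((fun t => (x t).1.1.2) @ \oo --> a)%classic.
  by apply: tends => t; have [_ []] := Hx t.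
have Hb : ((fun t => (x t).1.2) @ \oo --> b)%classic.
  by apply: tends => t; have [_ []] := Hx t.
have Hd : ((fun t => (x t).2) @ \oo --> d)%classic.
  by apply: tends => t; have [_ []] := Hx t.
(* Only [q], [a], [b], [d] are perturbed; [c] and [e] are recomputed, so both balancing conditions
   persist along the sequence. *)
have cE : c = a ^+ 2 * q ^+ n.+1 / b by rewrite -bc mulrC mulKf.
have eE : e = a * q ^+ n.+1 / d by rewrite -de mulrC mulKf.
have Hc : ((fun t => (x t).1.1.2 ^+ 2 * (x t).1.1.1 ^+ n.+1 / (x t).1.2) @ \oo --> c)%classic.
  rewrite cE; exact: (cvg_divf b0 (cvgMf (cvg_expf (k := 2) Ha) (cvg_expf (k := n.+1) Hq)) Hb).
have He : ((fun t => (x t).1.1.2 * (x t).1.1.1 ^+ n.+1 / (x t).2) @ \oo --> e)%classic.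
  rewrite eE; exact: (cvg_divf d0 (cvgMf Ha (cvg_expf (k := n.+1) Hq)) Hd).
have L := cubic_lhs_cvg p1 q0 a0 b0 c0 d0 e0 Hq Ha Hb Hc Hd He Ea Hl.
have M := cubic_rhs_cvg p1 q0 a0 b0 c0 d0 e0 Hq Ha Hb Hc Hd He Hr EA Ho.
apply/eqP; rewrite -subr_eq0; apply/eqP; apply: (cvg_const_eq (cvgBf L M)) => t.
have [[[q'0 a'0 b'0 d'0] gq ga gb gd] _] := Hx t.
apply/eqP; rewrite subr_eq0; apply/eqP.
apply: cubic_generic_params => // z; by have [] := gd z.
Qed.
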